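(* Let $P = \{x\in\mathbb{R}^n : \langle x,a_i\rangle \leq 1,\ 1\leq i\leq m\}$ be a centered simple $n$-dimensional polytope, given by its irredundant description, with facets $F_i = P\cap\{x\in\mathbb{R}^n:\langle a_i,x\rangle=1\}$ and cones $C_i=\mathrm{conv}(\{0\}\cup F_i)$ for $1\leq i\leq m$. Let $1\leq k\leq n-1$, let $F$ be a $k$-dimensional face of $P$, and let $A\subset\mathbb{R}^n$ be the affine subspace that is the affine hull of all those $a_i$ for which $F\subseteq F_i$. Then $$\sum_{i:\,a_i\in A} \mathrm{vol}(C_i)= \frac{\dim A+1}{n+1}\,\mathrm{vol}(P)$$ if and only if $P$ is a centered simplex.
   Context: A polytope is the convex hull of a finite set of points in $\mathbb{R}^n$. Every $n$-dimensional polytope $P\subset\mathbb{R}^n$ with $0$ in its interior has a unique (irredundant) representation $P=\{x\in\mathbb{R}^n:\langle a_i,x\rangle\leq 1,\ 1\leq i\leq m\}$, where the $a_i\in\mathbb{R}^n\setminus\{0\}$ are pairwise different and the sets $F_i=P\cap\{x:\langle a_i,x\rangle=1\}$ are exactly the facets (the $(n-1)$-dimensional faces) of $P$. The polytope $P$ is called centered if its centroid $\mathrm{c}(P)=\mathrm{vol}(P)^{-1}\int_P x\,dx$ equals $0$ (then $0$ is an interior point of $P$). $\mathrm{vol}$ is $n$-dimensional Lebesgue measure. An $n$-dimensional polytope is simple if every vertex is contained in exactly $n$ facets. *)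

(* Defs.v *)
From HB Require Import structures.
From mathcomp Require Import all_boot all_order all_algebra.
From mathcomp Require Import all_classical all_reals all_analysis.

Set Implicit Arguments.
Unset Strict Implicit.
Unset Printing Implicit Defensive.

Import Order.TTheory GRing.Theory Num.Theory.
Import numFieldNormedType.Exports.

Local Open Scope classical_set_scope.
Local Open Scope ring_scope.

(* The points of R^n are the row vectors 'rV[R]_n. They carry the sigma-algebra
   generated by the coordinates, i.e. the Borel sigma-algebra of R^n. *)

Section measurable_rV.
Context (R : realType) (n : nat).

Definition rV_coord (i : 'I_n) (v : 'rV[R]_n) : R := v 0 i.

Let rV_set0 : g_sigma_preimage rV_coord set0.
Proof. exact: sigma_algebra0. Qed.

Let rV_setC A : g_sigma_preimage rV_coord A -> g_sigma_preimage rV_coord (~` A).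
Proof. exact: sigma_algebraC. Qed.

Let rV_bigcup (F : (set 'rV[R]_n)^nat) :
  (forall i, g_sigma_preimage rV_coord (F i)) ->
  g_sigma_preimage rV_coord (\bigcup_i (F i)).
Proof. exact: sigma_algebra_bigcup. Qed.

HB.instance Definition _ := @isMeasurable.Build default_measure_display
  'rV[R]_n (g_sigma_preimage rV_coord) rV_set0 rV_setC rV_bigcup.

Lemma measurable_rV_coord (i : 'I_n) : measurable_fun setT (rV_coord i).
Proof.
move=> _ Y mY; rewrite setTI; apply: sub_sigma_algebra => /=.
rewrite -bigcup_seq/=; exists i => /=; first by rewrite mem_index_enum.
by exists Y => //; rewrite setTI.
Qed.

Lemma measurable_fun_rV d (T : measurableType d) (f : T -> 'rV[R]_n) :
  (forall i, measurable_fun setT (fun t => f t 0 i)) -> measurable_fun setT f.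
Proof.
move=> mf; apply: (@measurability _ _ _ _ _ _
  (\big[setU/set0]_(i < n) preimage_set_system setT (rV_coord i) measurable)) => //.
move=> A [C + <-{A}]; rewrite -bigcup_seq/= => -[i _ [B mB <-]].
by rewrite setTI; exact: mf.
Qed.

End measurable_rV.

Section lebesgue_rV.
Local Open Scope ereal_scope.
Context (R : realType).

Definition rV_cons n (p : measurableTypeR R * 'rV[R]_n) : 'rV[R]_n.+1 :=
  \row_j (if unlift ord0 j is Some i then p.2 0%R i else p.1).

Definition rV_uncons n (v : 'rV[R]_n.+1) : measurableTypeR R * 'rV[R]_n :=
  (v 0 ord0, \row_j v 0 (lift ord0 j))%R.

Lemma rV_cons0 n p : (@rV_cons n p) 0%R ord0 = p.1.
Proof. by rewrite mxE unlift_none. Qed.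

Lemma rV_consS n p j : (@rV_cons n p) 0%R (lift ord0 j) = p.2 0%R j.
Proof. by rewrite mxE liftK. Qed.

Lemma rV_consK n : cancel (@rV_cons n) (@rV_uncons n).
Proof.
move=> [x v]; rewrite /rV_uncons rV_cons0; congr pair.
by apply/rowP => j; rewrite mxE rV_consS.
Qed.

Lemma measurable_rV_cons n : measurable_fun setT (@rV_cons n).
Proof.
apply: measurable_fun_rV => i; have [j ->|->] := unliftP ord0 i.
  under eq_fun do rewrite rV_consS.
  exact: (measurableT_comp (@measurable_rV_coord R n j) measurable_snd).
under eq_fun do rewrite rV_cons0.
exact: measurable_fst.
Qed.

Lemma measurable_rV_uncons n : measurable_fun setT (@rV_uncons n).
Proof.
apply/measurable_fun_pairP; split; first exact: (@measurable_rV_coord R n.+1 ord0).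
apply: measurable_fun_rV => j /=.
under eq_fun do rewrite mxE.
exact: (@measurable_rV_coord R n.+1 (lift ord0 j)).
Qed.


Section step.
Variables (n : nat) (mu : {sigma_finite_measure set 'rV[R]_n -> \bar R}).

Definition lebesgue_rV_step : set 'rV[R]_n.+1 -> \bar R :=
  pushforward (@lebesgue_measure R \x mu) (@rV_cons n).

Let step0 : lebesgue_rV_step set0 = 0.
Proof. by rewrite /lebesgue_rV_step /pushforward preimage_set0 measure0. Qed.

Let step_ge0 A : 0 <= lebesgue_rV_step A.
Proof.
rewrite /lebesgue_rV_step /pushforward.
exact: (measure_ge0 (@lebesgue_measure R \x mu)).
Qed.

Let step_sigma_additive : semi_sigma_additive lebesgue_rV_step.
Proof.
move=> F mF tF mUF; rewrite /lebesgue_rV_step /pushforward preimage_bigcup.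
apply: measure_semi_sigma_additive.
- by move=> k; rewrite -[X in measurable X]setTI; exact: measurable_rV_cons.
- apply/trivIsetP => /= i j _ _ ij; rewrite -preimage_setI.
  by move/trivIsetP : tF => /(_ _ _ _ _ ij) ->//; rewrite preimage_set0.
- rewrite -preimage_bigcup -[X in measurable X]setTI.
  exact: measurable_rV_cons.
Qed.

HB.instance Definition _ := isMeasure.Build _ _ _ lebesgue_rV_step
  step0 step_ge0 step_sigma_additive.

(* Proved by hand: the canonical sigma-finite structure on m1 \x m2 is the one
   of products of subprobabilities, which does not apply here. *)
Let step_sigma_finite : sigma_finite setT lebesgue_rV_step.
Proof.
have /sigma_finiteP[F [TF ndF Foo]] := sigma_finiteT (@lebesgue_measure R).
have /sigma_finiteP[G [TG ndG Goo]] := sigma_finiteT mu.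
exists (fun k => @rV_uncons n @^-1` (F k `*` G k)).
  apply/esym; rewrite -subTset => v _.
  have [/= i _ Fi] : (\bigcup_k F k) (v 0%R ord0) by rewrite -TF.
  have [/= j _ Gj] : (\bigcup_k G k) (@rV_uncons n v).2 by rewrite -TG.
  exists (maxn i j) => //; split => /=.
    by move: Fi; exact/subsetPset/ndF/leq_maxl.
  by move: Gj; exact/subsetPset/ndG/leq_maxr.
move=> k; have [mF Fk] := Foo k; have [mG Gk] := Goo k; split.
  rewrite -[X in measurable X]setTI; apply: measurable_rV_uncons => //.
  exact: measurableX.
rewrite /lebesgue_rV_step /pushforward -comp_preimage.
rewrite (_ : _ \o _ = id); last by apply/funext => p /=; rewrite rV_consK.
by rewrite preimage_id product_measure1E// lte_mul_pinfty// ge0_fin_numE.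
Qed.

HB.instance Definition _ := Measure_isSigmaFinite.Build _ _ _ lebesgue_rV_step
  step_sigma_finite.

End step.

(* n-dimensional Lebesgue measure: the n-fold product of the Lebesgue measure
   of R. *)
Fixpoint lebesgue_rV n : {sigma_finite_measure set 'rV[R]_n -> \bar R} :=
  if n is n'.+1 then lebesgue_rV_step (lebesgue_rV n')
  else dirac (0 : 'rV[R]_0)%R.

Lemma lebesgue_rV_box n (B : 'I_n -> set R) :
  (forall i, measurable (B i)) ->
  lebesgue_rV n [set v : 'rV[R]_n | forall i, B i (v 0%R i)] =
  \prod_(i < n) lebesgue_measure (B i).
Proof.
elim: n B => [|n IHn] B mB.
  rewrite big_ord0 /= diracE mem_set//; by case.
have consB : @rV_cons n @^-1` [set v : 'rV[R]_n.+1 | forall i, B i (v 0%R i)] =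
    B ord0 `*` [set v : 'rV[R]_n | forall i, B (lift ord0 i) (v 0%R i)].
  apply/seteqP; split=> [p Bp|p [B0 BS] i] /=.
    split=> [|i /=]; first by have := Bp ord0; rewrite rV_cons0.
    by have := Bp (lift ord0 i); rewrite rV_consS.
  have [j ->|->] := unliftP ord0 i; last by rewrite rV_cons0.
  by rewrite rV_consS; exact: BS.
transitivity ((@lebesgue_measure R \x lebesgue_rV n)
    (B ord0 `*` [set v : 'rV[R]_n | forall i, B (lift ord0 i) (v 0%R i)])).
  by rewrite -consB.
rewrite big_ord_recl product_measure1E//; first by congr *%E; exact: IHn.
  exact: mB.
rewrite (_ : [set v : 'rV[R]_n | _] = \bigcap_(i in [set: 'I_n])
    (@rV_coord R n i @^-1` B (lift ord0 i))); last first.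
  by apply/seteqP; split=> [v Bv i _|v Bv i]; [exact: Bv|exact: (Bv i)].
apply: fin_bigcap_measurable => // i _; rewrite -[X in measurable X]setTI.
exact: measurable_rV_coord.
Qed.

End lebesgue_rV.

Notation vol := (lebesgue_rV _ _).

Section affine.
Context (R : realType) (n : nat).
Implicit Types (S A : set 'rV[R]_n) (U : {vspace 'rV[R]_n}).

Definition affine_space (x0 : 'rV[R]_n) U : set 'rV[R]_n :=
  [set x | x - x0 \in U].

Definition affine_subspace A :=
  A = set0 \/ exists x0 U, A = affine_space x0 U.

Definition affine_hull S : set 'rV[R]_n := smallest affine_subspace S.

Definition convex_hull S : set 'rV[R]_n := smallest (@convex_set R 'rV[R]_n) S.

(* The dimension of the affine hull; the empty set has dimension -1. *)
Definition affine_dim S : int :=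
  xget (-1) [set d | exists x0 U,
                     affine_hull S = affine_space x0 U /\ d = (\dim U)%:Z].

Lemma affine_space_translate x0 x1 U :
  affine_space x0 U x1 -> affine_space x0 U = affine_space x1 U.
Proof.
move=> x01; rewrite /affine_space; apply/funext => x /=.
rewrite (_ : x - x0 = (x - x1) + (x1 - x0)); last by rewrite addrA subrK.
by rewrite rpredDr.
Qed.

Lemma affine_space_inj x0 x1 U V :
  affine_space x0 U = affine_space x1 V -> U = V.
Proof.
move=> UV; have x0U : affine_space x0 U x0 by rewrite /affine_space/= subrr mem0v.
have := x0U; rewrite {1}UV => /affine_space_translate V01.
apply/vspaceP => v.
have : affine_space x0 U (v + x0) = affine_space x0 V (v + x0).
  by rewrite UV V01.
by rewrite /affine_space/= addrK => vUV; apply/idP/idP; rewrite vUV.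
Qed.

Lemma affine_dimE S x0 U :
  affine_hull S = affine_space x0 U -> affine_dim S = (\dim U)%:Z.
Proof.
move=> SU; rewrite /affine_dim; case: xgetP => [d _ [x1 [V [SV ->]]]|h].
  by rewrite (@affine_space_inj x1 x0 V U)// -SV.
by case: (h (\dim U)%:Z); exists x0, U.
Qed.

Lemma affine_hullE S : S !=set0 ->
  exists x0 U, affine_hull S = affine_space x0 U.
Proof.
move=> [x0 Sx0].
pose Q (d : nat) := `[< exists U, S `<=` affine_space x0 U /\ \dim U = d >].
have exQ : exists d, Q d.
  exists (\dim {:'rV[R]_n}); apply/asboolP; exists fullv; split=> // x _.
  by rewrite /affine_space/= memvf.
case: (ex_minnP exQ) => d /asboolP[U [SU dU]] dmin.
exists x0, U; apply/seteqP; split.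
  by apply: smallest_sub => //; right; exists x0, U.
move=> x xU _ [[->|[x1 [V ->]]] SV]; first by have := SV _ Sx0.
have V01 := affine_space_translate (SV _ Sx0).
rewrite V01 in SV *.
suff /subvP UV : (U <= V)%VS by exact: UV.
apply/capv_idPl/eqP; rewrite eqEdim capvSl/= dU; apply: dmin.
apply/asboolP; exists (U :&: V)%VS; split=> // y Sy.
by rewrite /affine_space/= memv_cap; apply/andP; split; [exact: SU|exact: SV].
Qed.

Lemma affine_dim0 : affine_dim set0 = -1.
Proof.
rewrite /affine_dim xgetPN// => d [x0 [U [E _]]].
have : affine_hull set0 x0 by rewrite E /affine_space/= subrr mem0v.
by apply: (@smallest_sub _ affine_subspace set0 set0) => //; left.
Qed.

End affine.

Section polytopes.
Context (R : realType) (n : nat).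
Implicit Types (P F : set 'rV[R]_n) (a c v : 'rV[R]_n).

Definition dotp (x y : 'rV[R]_n) : R := (x *m y^T) 0 0.

Definition polytope P :=
  exists s : seq 'rV[R]_n, P = convex_hull [set` s].

(* Intersection of P with a supporting hyperplane; the valid inequalities
   0 <= 0 and 0 <= 1 give the improper faces P and set0. *)
Definition face P F := exists c (b : R),
  (forall x, P x -> dotp c x <= b) /\ F = P `&` [set x | dotp c x = b].

Definition facet P F := face P F /\ affine_dim F = n%:Z - 1.

Definition vertex P v := face P [set v].

Definition simple_polytope P :=
  forall v, vertex P v -> ([set G | facet P G /\ G v] #= `I_n)%card.

Definition centroid P : 'rV[R]_n :=
  (fine (vol P))^-1 *: \row_j \int[vol]_(x in P) x 0 j.

Definition centered P := centroid P = 0.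

Definition affinely_independent p (v : 'I_p -> 'rV[R]_n) :=
  forall l : 'I_p -> R,
    \sum_i l i = 0 -> \sum_i l i *: v i = 0 -> forall i, l i = 0.

Definition simplex P := exists v : 'I_n.+1 -> 'rV[R]_n,
  affinely_independent v /\ P = convex_hull (range v).

Definition face_of_normal P a : set 'rV[R]_n := P `&` [set x | dotp a x = 1].

Definition facet_cone P a : set 'rV[R]_n :=
  convex_hull ([set 0] `|` face_of_normal P a).

Definition irredundant_description m (a : 'I_m -> 'rV[R]_n) P :=
  [/\ P = [set x | forall i, dotp (a i) x <= 1],
      forall i, a i != 0,
      injective a &
      [set G | facet P G] = range (fun i => face_of_normal P (a i))].

End polytopes.

(* Main.v *)
Require Import Defs.
From mathcomp Require Import all_boot all_order all_algebra.
From mathcomp Require Import all_classical all_reals all_analysis.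
From mathcomp Require Import measurable_realfun ring lra.

Set Implicit Arguments.
Unset Strict Implicit.
Unset Printing Implicit Defensive.

Import Order.TTheory GRing.Theory Num.Theory.
Import numFieldNormedType.Exports.

Local Open Scope classical_set_scope.
Local Open Scope ring_scope.

(* Write v for the volume of P, c_i for that of the cone over F_i, and s for the
   slack 1 - <a_i, x>. For every facet c_i <= v / (n + 1), with equality only if
   P is a pyramid over F_i. Indeed let V(z) be the volume of the part of P where
   s >= z. The slab s < e contains most of the cone over F_i, so V decreases at
   rate at least n c_i at 0, and Brunn-Minkowski gives
   V(z) <= v (1 - z c_i / v)^n. As P is centered, s has integral v over P, which
   is also the integral of V, hence v <= v^2 / ((n + 1) c_i). In case of equality
   the maximum of s is n + 1, attained at some p, and the part of P where s >= z
   has the volume of the dilate of P about p that it contains; hence they are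
   equal and P is a pyramid with apex p.

   Since P is simple, the normals of the facets containing F are linearly
   independent and are exactly the a_i in A, so there are dim A + 1 of them and
   the equation says that each of their cones has volume v / (n + 1). A simple
   pyramid has exactly n facets through its apex, hence n + 1 facets, and is a
   simplex. Conversely, in a simplex the n + 1 cones cover P, and each has volume
   at most v / (n + 1), so all of them have volume exactly v / (n + 1). *)

(** * Lebesgue measure on the line *)

(** The volume is an iterated product measure, so Brunn-Minkowski is proved by induction over
    slices. The multiplicative form is the one that passes through this induction, and the induction
    step needs its functional version on the line, the Prekopa-Leindler inequality. The concavity of
    V^(1/n) is then not directly at hand. It is recovered by applying the multiplicative form to P
    and to a dilate of the part s >= z with a free ratio r, and by choosing r best at the end. The
    bound on V is the tangent line at 0 of the concave function V^(1/n); the comparison with the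
    slab is made to first order with an explicit quadratic error, so V is never differentiated.

    On the combinatorial side boundedness acts through one fact: P contains no ray, so a vector d
    with <a_i, d> <= 0 for all i is 0. Faces are explored by moving along directions orthogonal to
    the active normals until a new constraint becomes tight. *)

Section affine_lebesgue_measure.
Context {R : realType}.
Implicit Types t u : R.
Local Notation mu := (@lebesgue_measure R).
Local Notation RR := (measurableTypeR R).

Definition line_homothety t u : RR -> RR := fun x => t * x + u.

Lemma measurable_line_homothety t u : measurable_fun setT (line_homothety t u).
Proof.
apply: measurable_funD => //; exact: measurable_funM.
Qed.

Let line_image t u : {measure set RR -> \bar R} :=
  measure_function_pushforward__canonical__measure_function_Measure
    (mu : {measure set RR -> \bar R}) (measurable_line_homothety t u).

(** Both sides are measures in [A] that agree on half-open intervals, so uniqueness of Lebesgue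
    measure applies. *)
Lemma lebesgue_measure_homothety t u (A : set RR) : 0 < t -> measurable A ->
  mu A = (t%:E * mu (line_homothety t u @^-1` A))%E.
Proof.
move=> t0 mA.
pose nt : {nonneg R} := NngNum (ltW t0).
transitivity (mscale nt (line_image t u) A); last by [].
apply: lebesgue_measure_unique => // _ [[a b] _ <-].
rewrite /mscale /line_image /= /pushforward.
transitivity (t%:E * mu (line_homothety t u @^-1` `]a, b]))%E; last by [].
rewrite [X in (_ * _ X)%E](_ : _ = `](a - u) / t, (b - u) / t]%classic); last first.
  apply/seteqP; split => x /=; rewrite !in_itv/= /line_homothety;
    rewrite ltr_pdivrMr// ler_pdivlMr// ltrBlDr lerBrDr mulrC; by [].
rewrite !lebesgue_measure_itv/= !lte_fin ltr_pM2r ?invr_gt0// ltrD2r.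
case: ifPn => _; last by rewrite mule0.
by rewrite -!EFinB -EFinM -mulrBl mulrC divfK ?gt_eqF//; congr EFin; ring.
Qed.

Lemma ge0_integral_homothety t u (f : RR -> \bar R) : 0 < t ->
  measurable_fun setT f -> (forall x, 0 <= f x)%E ->
  (\int[mu]_x f x = t%:E * \int[mu]_x f (line_homothety t u x))%E.
Proof.
move=> t0 mf f0.
pose nt : {nonneg R} := NngNum (ltW t0).
transitivity (\int[mscale nt (line_image t u)]_x f x)%E.
  apply: eq_measure_integral => A mA _.
  exact: (lebesgue_measure_homothety u t0).
rewrite ge0_integral_mscale//.
rewrite ge0_integral_pushforward// ?preimage_setT//.
exact: measurable_line_homothety.
Qed.

(* For [x0] near [sup A] and [y0] near [inf B], the sets [A + y0] and [x0 + B]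
   essentially lie on opposite sides of [x0 + y0]. *)
Lemma lebesgue_measure_sumset (A B C : set RR) (N : R) :
  measurable A -> measurable B -> measurable C ->
  A !=set0 -> B !=set0 ->
  A `<=` [set x | `|x| <= N] -> B `<=` [set x | `|x| <= N] ->
  (forall x y, A x -> B y -> C (x + y)) ->
  (mu A + mu B <= mu C)%E.
Proof.
move=> mA mB mC [a0 Aa0] [b0 Bb0] AN BN ABC.
have supA : has_sup A.
  by split; [exists a0|exists N => x /AN /=; rewrite ler_norml => /andP[]].
have infB : has_inf B.
  by split; [exists b0|exists (- N) => x /BN /=; rewrite ler_norml => /andP[]].
apply/lee_addgt0Pr => e e0.
have e20 : 0 < e / 2 by rewrite divr_gt0.
have [x0 Ax0 supx0] := sup_adherent e20 supA.
have [y0 By0 infy0] := inf_adherent e20 infB.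
pose A1 := A `&` `]-oo, x0]; pose B1 := B `&` `]y0, +oo[.
have mA1 : measurable A1 by exact: measurableI.
have mB1 : measurable B1 by exact: measurableI.
have leA : (mu A <= mu A1 + (e / 2)%:E)%E.
  apply: (@le_trans _ _ (mu (A1 `|` `]x0, sup A]%classic))).
    apply: le_measure; rewrite ?inE//; first exact: measurableU.
    move=> x Ax; have [xx0|x0x] := leP x x0; [left|right]; first by split.
    by rewrite /= in_itv/= x0x; apply: sup_ubound => //; case: supA.
  apply: (le_trans (measureU2 _ _ _)) => //.
  apply: leeD => //; rewrite /= lebesgue_measure_itv/= lte_fin.
  by case: ifPn => _; rewrite -?EFinB lee_fin; move: (ltW supx0) (ltW e20); lra.
have leB : (mu B <= mu B1 + (e / 2)%:E)%E.
  apply: (@le_trans _ _ (mu (B1 `|` `[inf B, y0]%classic))).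
    apply: le_measure; rewrite ?inE//; first exact: measurableU.
    move=> y By; have [yy0|y0y] := leP y y0; [right|left].
      by rewrite /= in_itv/= yy0 andbT; apply: inf_lbound => //; case: infB.
    by split=> //=; rewrite in_itv/= andbT.
  apply: (le_trans (measureU2 _ _ _)) => //.
  apply: leeD => //; rewrite /= lebesgue_measure_itv/= lte_fin.
  by case: ifPn => _; rewrite -?EFinB lee_fin; move: (ltW infy0) (ltW e20); lra.
pose D1 := line_homothety 1 (- y0) @^-1` A1.
pose D2 := line_homothety 1 (- x0) @^-1` B1.
have mD1 : measurable D1.
  by rewrite -[D1]setTI; exact: measurable_line_homothety.
have mD2 : measurable D2.
  by rewrite -[D2]setTI; exact: measurable_line_homothety.
have -> : (mu C + e%:E = mu C + (e / 2)%:E + (e / 2)%:E)%E.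
  by rewrite -addeA -EFinD -splitr.
apply: (le_trans (leeD leA leB)).
rewrite addeACA -[leRHS]addeA; apply: leeD => //.
rewrite (lebesgue_measure_homothety (- y0) ltr01 mA1) mul1e.
rewrite (lebesgue_measure_homothety (- x0) ltr01 mB1) mul1e.
rewrite -measureU//; last first.
  apply/seteqP; split => // z [[_ +] [_ +]]; rewrite /= /line_homothety !in_itv/= andbT mul1r.
  lra.
apply: le_measure; rewrite ?inE//; first exact: measurableU.
move=> z [[Az _]|[Bz _]].
  by have := ABC _ _ Az By0; rewrite /line_homothety mul1r subrK.
by have := ABC _ _ Ax0 Bz; rewrite /line_homothety mul1r addrC subrK.
Qed.

End affine_lebesgue_measure.

(** * Integrals through superlevel sets *)

Section layer_cake.
Context d (T : measurableType d) (R : realType).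
Variable m : {sigma_finite_measure set T -> \bar R}.
Local Notation mu := (@lebesgue_measure R).
Local Notation RR := (measurableTypeR R).

Lemma measurable_superlevel (f : T -> R) (r : R) :
  measurable_fun setT f -> measurable [set x | r < f x].
Proof.
move=> mf; rewrite (_ : [set x | _] = (fun x => r < f x) @^-1` [set true])//.
by rewrite -[X in measurable X]setTI; apply: measurable_fun_ltr.
Qed.

Lemma measurable_fun_superlevel (f : T -> R) :
  measurable_fun setT f ->
  measurable_fun setT (fun r : RR => m [set x | r < f x]).
Proof.
move=> mf.
pose S := [set q : T * RR | q.2 < f q.1].
have mS : measurable S.
  rewrite (_ : S = (fun q : T * RR => q.2 < f q.1) @^-1` [set true])//.
  rewrite -[X in measurable X]setTI.
  by apply: measurable_fun_ltr => //; exact: measurableT_comp.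
have := measurable_fun_ysection m mS.
apply: eq_measurable_fun => r _ /=; congr (m _).
by apply/seteqP; split => x; rewrite /ysection /S /= inE.
Qed.

(** Tonelli for the indicator of the region under the graph: its fibre over [x] is an interval of
    length [f x], its fibre over [r >= 0] a superlevel set. *)
Lemma layer_cake (f : T -> R) : measurable_fun setT f -> (forall x, 0 <= f x) ->
  (\int[m]_x (f x)%:E =
   \int[mu]_(r in `[0%R, +oo[) m [set x | (r < f x)%R])%E.
Proof.
move=> mf f0.
pose g (p : T * RR) : R := \1_([set q : T * RR | 0 <= q.2 < f q.1]) p.
have mset : measurable [set q : T * RR | 0 <= q.2 < f q.1].
  rewrite (_ : [set q | _] = (fun q : T * RR => 0 <= q.2) @^-1` [set true] `&`
                (fun q : T * RR => q.2 < f q.1) @^-1` [set true]); last first.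
    by apply/seteqP; split => p /= /andP.
  apply: measurableI; rewrite -[X in measurable X]setTI.
    by apply: measurable_fun_ler.
  by apply: measurable_fun_ltr => //; exact: measurableT_comp.
have mg : measurable_fun setT (EFin \o g).
  by apply/measurable_EFinP; exact: measurable_indic.
transitivity (\int[m]_x \int[mu]_r (EFin \o g) (x, r))%E.
  apply: eq_integral => x _; rewrite /g.
  transitivity (\int[mu]_r (\1_(`[0, f x[%classic : set RR) r)%:E)%E; last first.
    by apply: eq_integral => r _ /=; congr EFin; rewrite !indicE; congr (_%:R);
      apply/idP/idP; rewrite !inE/= in_itv.
  rewrite integral_indic//= setIT lebesgue_measure_itv/= lte_fin sube0.
  by have := f0 x; rewrite le_eqVlt => /predU1P[<-|->]; rewrite ?ltxx.
rewrite (fubini_tonelli (EFin \o g)) //; last by move=> p; rewrite /= lee_fin.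
rewrite [RHS]integral_mkcond; apply: eq_integral => r _; rewrite patchE.
case: ifPn => r0; last first.
  apply: integral0_eq => x _; rewrite /g /= indicE memNset//= => /andP[r0' _].
  by move/negP: r0; apply; rewrite inE /= in_itv/= r0'.
rewrite inE/= in_itv/= andbT in r0.
transitivity (\int[m]_x (\1_[set x | r < f x] x)%:E)%E.
  apply: eq_integral => x _ /=; rewrite /g !indicE; congr (((nat_of_bool _)%:R)%:E).
  by apply/idP/idP; rewrite !inE/= r0.
rewrite integral_indic ?setIT//.
exact: measurable_superlevel.
Qed.

End layer_cake.

(** * The Prekopa-Leindler inequality *)

Section prekopa_leindler.
Context {R : realType}.
Local Notation mu := (@lebesgue_measure R).
Local Notation RR := (measurableTypeR R).

(** Young's inequality for the conjugate exponents [(1 - l)^-1] and [l^-1]. *)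
Lemma weighted_am_gm (l a b : R) : 0 < l < 1 -> 0 <= a -> 0 <= b ->
  a `^ (1 - l) * b `^ l <= (1 - l) * a + l * b.
Proof.
move=> /andP[l0 l1] a0 b0.
have l1' : 0 < 1 - l by rewrite subr_gt0.
have := @conjugate_powR _ (a `^ (1 - l)) (b `^ l) (1 - l)^-1 l^-1
  (powR_ge0 _ _) (powR_ge0 _ _).
rewrite !invr_gt0 !invrK => /(_ l1' l0); rewrite subrK => /(_ erefl).
rewrite -!powRrM !mulfV ?gt_eqF// !powRr1//.
by rewrite [a * _]mulrC [b * _]mulrC.
Qed.

(** As both suprema are 1, at every level [r] in [0, 1[ both superlevel sets are nonempty and the
    sumset inequality applies; integrating over [r] gives even the arithmetic mean. [N] bounds the
    supports, as the sumset inequality requires. *)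
Lemma prekopa_leindler_normalized (l N : R) (f g h : RR -> R) :
  0 < l < 1 ->
  measurable_fun setT f -> measurable_fun setT g -> measurable_fun setT h ->
  (forall x, 0 <= f x <= 1) -> (forall x, 0 <= g x <= 1) -> (forall x, 0 <= h x) ->
  (forall r, r < 1 -> exists x, r < f x) -> (forall r, r < 1 -> exists x, r < g x) ->
  (forall x, 0 < f x -> `|x| <= N) -> (forall x, 0 < g x -> `|x| <= N) ->
  (forall x y, f x `^ (1 - l) * g y `^ l <= h ((1 - l) * x + l * y)) ->
  ((1 - l)%:E * (\int[mu]_x (f x)%:E) + l%:E * (\int[mu]_x (g x)%:E) <=
   \int[mu]_x (h x)%:E)%E.
Proof.
move=> /andP[l0 l1] mf mg mh f01 g01 h0 supf supg fN gN fgh.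
have l1' : 0 < 1 - l by rewrite subr_gt0.
have f0 x : 0 <= f x by have /andP[] := f01 x.
have g0 x : 0 <= g x by have /andP[] := g01 x.
have lcake (k : RR -> R) : measurable_fun setT k -> (forall x, 0 <= k x <= 1) ->
    (\int[mu]_x (k x)%:E = \int[mu]_(r in `[0%R, 1%R[) mu [set x | (r < k x)%R])%E.
  move=> mk k01; rewrite layer_cake//; last by move=> x; have /andP[] := k01 x.
  rewrite integral_mkcond [RHS]integral_mkcond; apply: eq_integral => r _.
  rewrite !patchE !mem_setE !in_itv/= andbT.
  have [r0|] //= := boolP (0 <= r).
  have [r1|r1] //= := ltP r 1.
  rewrite (_ : [set x | _] = set0) ?measure0//.
  apply/seteqP; split => // x /= rk; have /andP[_ k1] := k01 x.
  by move: (lt_le_trans rk k1); rewrite ltNge r1.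
have msl (k : RR -> R) D : measurable_fun setT k ->
    measurable_fun D (fun r : RR => mu [set x | r < k x]).
  by move=> mk; apply: measurable_funTS; exact: (measurable_fun_superlevel mu).
rewrite (lcake f)// (lcake g)// layer_cake//.
rewrite -!ge0_integralZl_EFin//; try exact: msl; try exact: ltW.
rewrite -ge0_integralD//=; last 4 first.
- by move=> r _; rewrite mule_ge0// lee_fin ltW.
- by apply: emeasurable_funM => //; exact: msl.
- by move=> r _; rewrite mule_ge0// lee_fin ltW.
- by apply: emeasurable_funM => //; exact: msl.
apply: (@le_trans _ _ (\int[mu]_(r in `[0%R, 1%R[) mu [set x | (r < h x)%R])%E); last first.
  apply: ge0_subset_integral => //; first exact: msl.
  by move=> r /=; rewrite !in_itv/= andbT => /andP[].
apply: ge0_le_integral => //.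
- by move=> r _; rewrite adde_ge0// mule_ge0// lee_fin ltW.
- by apply: emeasurable_funD; apply: emeasurable_funM => //; exact: msl.
- exact: msl.
move=> r /=; rewrite in_itv/= => /andP[r0 r1].
(* The superlevel sets scaled by [1 - l] and [l], so that the weighted combination becomes a plain
   sum. *)
pose A := line_homothety (1 - l)^-1 0 @^-1` [set x | r < f x].
pose B := line_homothety l^-1 0 @^-1` [set x | r < g x].
have mA : measurable A.
  rewrite -[A]setTI; apply: measurable_line_homothety => //.
  exact: measurable_superlevel.
have mB : measurable B.
  rewrite -[B]setTI; apply: measurable_line_homothety => //.
  exact: measurable_superlevel.
have -> : ((1 - l)%:E * mu [set x | (r < f x)%R] = mu A)%E.
  rewrite (lebesgue_measure_homothety 0 l1' mA); congr (_ * mu _)%E.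
  by apply/seteqP; split=> x; rewrite /A /line_homothety /= !addr0 mulKf ?gt_eqF.
have -> : (l%:E * mu [set x | (r < g x)%R] = mu B)%E.
  rewrite (lebesgue_measure_homothety 0 l0 mB); congr (_ * mu _)%E.
  by apply/seteqP; split=> x; rewrite /B /line_homothety /= !addr0 mulKf ?gt_eqF.
apply: (@lebesgue_measure_sumset _ A B _ N) => //.
- exact: measurable_superlevel.
- have [x rx] := supf _ r1; exists ((1 - l) * x).
  by rewrite /A /line_homothety /= addr0 mulKf ?gt_eqF.
- have [x rx] := supg _ r1; exists (l * x).
  by rewrite /B /line_homothety /= addr0 mulKf ?gt_eqF.
- move=> x; rewrite /A /line_homothety /= addr0 => rx.
  have := fN _ (le_lt_trans r0 rx); rewrite normrM gtr0_norm ?invr_gt0//.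
  rewrite ler_pdivrMl// => /le_trans; apply.
  have N0 : 0 <= N by apply: le_trans (fN _ (le_lt_trans r0 rx)).
  by rewrite ler_piMl// lerBlDr lerDl ltW.
- move=> x; rewrite /B /line_homothety /= addr0 => rx.
  have := gN _ (le_lt_trans r0 rx); rewrite normrM gtr0_norm ?invr_gt0//.
  rewrite ler_pdivrMl// => /le_trans; apply.
  have N0 : 0 <= N by apply: le_trans (gN _ (le_lt_trans r0 rx)).
  by rewrite ler_piMl// ltW.
- move=> x y; rewrite /A /B /line_homothety /= !addr0 => rx ry.
  apply: (@lt_le_trans _ _ (f ((1 - l)^-1 * x) `^ (1 - l) * g (l^-1 * y) `^ l)).
    rewrite -[r in ltLHS]powRr1// -[X in _ `^ X](subrK l) powRD; last first.
      by rewrite subrK oner_eq0.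
    apply: ltr_pM; rewrite ?powR_ge0//; by apply: gt0_ltr_powR => //; rewrite nnegrE.
  by apply: (le_trans (fgh _ _)); rewrite !mulVKf ?gt_eqF.
Qed.

(** Divide [f] and [g] by their suprema and [h] by the weighted geometric mean [sh] of these. The
    arithmetic mean of the normalized inequality dominates the geometric one, and [sh] is multiplied
    back. *)
Lemma prekopa_leindler_line (l N K a b : R) (f g h : RR -> R) :
  0 < l < 1 ->
  measurable_fun setT f -> measurable_fun setT g -> measurable_fun setT h ->
  (forall x, 0 <= f x <= K) -> (forall x, 0 <= g x <= K) -> (forall x, 0 <= h x) ->
  (forall x, 0 < f x -> `|x| <= N) -> (forall x, 0 < g x -> `|x| <= N) ->
  (forall x y, f x `^ (1 - l) * g y `^ l <= h ((1 - l) * x + l * y)) ->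
  (\int[mu]_x (f x)%:E = a%:E)%E -> (\int[mu]_x (g x)%:E = b%:E)%E ->
  ((a `^ (1 - l) * b `^ l)%:E <= \int[mu]_x (h x)%:E)%E.
Proof.
move=> l01 mf mg mh f0K g0K h0 fN gN fgh fa gb.
have /andP[l0 l1] := l01.
have l1' : 0 < 1 - l by rewrite subr_gt0.
have f0 x : 0 <= f x by have /andP[] := f0K x.
have g0 x : 0 <= g x by have /andP[] := g0K x.
have a0 : 0 <= a by rewrite -lee_fin -fa integral_ge0// => x _; rewrite lee_fin.
have b0 : 0 <= b by rewrite -lee_fin -gb integral_ge0// => x _; rewrite lee_fin.
have ih0 : (0 <= \int[mu]_x (h x)%:E)%E by apply: integral_ge0 => x _; rewrite lee_fin.
(* A zero integral makes the left side 0, both exponents being positive; a nonzero one makes the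
   supremum positive, hence a legitimate divisor. *)
have [->|aN0] := eqVneq a 0; first by rewrite powR0 ?mul0r// gt_eqF.
have [->|bN0] := eqVneq b 0; first by rewrite powR0 ?mulr0// gt_eqF.
have hs (k : RR -> R) (c : R) : (forall x, 0 <= k x <= K) ->
    (\int[mu]_x (k x)%:E = c%:E)%E -> c != 0 ->
    [/\ 0 < sup (range k), forall x, k x <= sup (range k) &
        forall r, r < 1 -> exists x, r < k x / sup (range k)].
  move=> k0K kc cN0.
  have hsk : has_sup (range k).
    split; first by exists (k 0), 0.
    by exists K => _ [x _ <-]; have /andP[] := k0K x.
  have ub x : k x <= sup (range k) by apply: sup_ubound; [case: hsk|exists x].
  have s0 : 0 < sup (range k).
    rewrite lt_neqAle (le_trans _ (ub 0)) ?andbT; last by have /andP[] := k0K 0.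
    apply/negP => /eqP s0; move/negP: cN0; apply; rewrite -eqe -kc integral0_eq// => x _.
    by congr EFin; apply/eqP; rewrite eq_le [in X in _ && X](_ : 0 <= k x) ?andbT;
      [rewrite s0|have /andP[] := k0K x].
  split=> // r r1.
  have e0 : 0 < (1 - r) * sup (range k) by rewrite mulr_gt0// subr_gt0.
  have [_ [x _ <-]] := sup_adherent e0 hsk.
  by rewrite mulrBl mul1r opprB addrC subrK => rx; exists x; rewrite ltr_pdivlMr.
have [sf0 fsf supf] := hs f a f0K fa aN0.
have [sg0 gsg supg] := hs g b g0K gb bN0.
set sf := sup (range f) in sf0 fsf supf.
set sg := sup (range g) in sg0 gsg supg.
pose sh := sf `^ (1 - l) * sg `^ l.
have sh0 : 0 < sh by rewrite mulr_gt0// powR_gt0.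
have iZ (k : RR -> R) (s c : R) : measurable_fun setT k -> (forall x, 0 <= k x) -> 0 < s ->
    (\int[mu]_x (k x / s)%:E = (s^-1)%:E * \int[mu]_x (k x)%:E)%E.
  move=> mk k0 s0.
  rewrite -ge0_integralZl_EFin//; last by rewrite invr_ge0 ltW.
  by apply: eq_integral => x _; rewrite mulrC.
  by move=> x _; rewrite lee_fin.
  exact/measurable_EFinP.
have := @prekopa_leindler_normalized l N (fun x => f x / sf) (fun x => g x / sg)
  (fun x => h x / sh) l01.
rewrite !iZ// fa gb => H.
have {H} : ((1 - l)%:E * ((sf^-1)%:E * a%:E) + l%:E * ((sg^-1)%:E * b%:E) <=
    (sh^-1)%:E * \int[mu]_x (h x)%:E)%E.
  apply: H.
  - by apply: measurable_funM.
  - by apply: measurable_funM.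
  - by apply: measurable_funM.
  - by move=> x; rewrite divr_ge0 ?(ltW sf0)//= ler_pdivrMr// mul1r.
  - by move=> x; rewrite divr_ge0 ?(ltW sg0)//= ler_pdivrMr// mul1r.
  - by move=> x; rewrite divr_ge0// ltW.
  - exact: supf.
  - exact: supg.
  - by move=> x; rewrite pmulr_lgt0 ?invr_gt0//; exact: fN.
  - by move=> x; rewrite pmulr_lgt0 ?invr_gt0//; exact: gN.
  - move=> x y; rewrite ler_pdivlMr// (le_trans _ (fgh x y))//.
    rewrite /sh mulrACA -!powRM ?divr_ge0 ?(ltW sf0) ?(ltW sg0)//.
    by rewrite !divfK ?gt_eqF.
rewrite -!EFinM -EFinD => H.
rewrite (_ : a `^ (1 - l) * b `^ l = sh * ((sf^-1 * a) `^ (1 - l) * (sg^-1 * b) `^ l)); last first.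
  rewrite /sh mulrACA -!powRM ?mulr_ge0 ?invr_ge0 ?(ltW sf0) ?(ltW sg0)//.
  by rewrite !mulVKf ?gt_eqF.
rewrite -[leRHS]mul1e -[1%E](_ : (sh * sh^-1)%:E = _); last by rewrite mulfV ?gt_eqF.
rewrite EFinM [in leRHS]EFinM -muleA lee_pmul2l ?lte_fin//.
apply: le_trans H; rewrite lee_fin; apply: weighted_am_gm => //.
  by rewrite mulr_ge0// invr_ge0 ltW.
by rewrite mulr_ge0// invr_ge0 ltW.
Qed.

End prekopa_leindler.

(** * The Brunn-Minkowski inequality and homotheties *)

Section lebesgue_rV_slices.
Context {R : realType}.
Local Notation mu := (@lebesgue_measure R).
Local Notation RR := (measurableTypeR R).
Local Notation volume n := (lebesgue_rV R n).

Definition slice n (A : set 'rV[R]_n.+1) (t : RR) : set 'rV[R]_n :=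
  [set w | A (rV_cons (t, w))].

(** Boundedness is expressed by cubes because slices of a set in a cube lie in the cube with the
    same [N], as inductions on the dimension require. *)
Definition cube n (N : R) : set 'rV[R]_n := [set v | forall i, `|v 0 i| <= N].
Arguments cube : clear implicits.

Lemma measurable_preimage_rV_cons n (A : set 'rV[R]_n.+1) :
  measurable A -> measurable (@rV_cons R n @^-1` A).
Proof. by move=> mA; rewrite -[X in measurable X]setTI; exact: measurable_rV_cons. Qed.

Lemma lebesgue_rV0 (A : set 'rV[R]_0) : volume 0 A = (0 \in A)%:R%:E.
Proof. by rewrite /= -diracE. Qed.

Lemma sliceE n (A : set 'rV[R]_n.+1) t :
  slice A t = xsection (@rV_cons R n @^-1` A) t.
Proof. by apply/seteqP; split => w; rewrite /slice /xsection /= inE. Qed.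

Lemma measurable_slice n (A : set 'rV[R]_n.+1) t :
  measurable A -> measurable (slice A t).
Proof.
by move=> mA; rewrite sliceE; apply: measurable_xsection; exact: measurable_preimage_rV_cons.
Qed.

Lemma measurable_fun_slice n (A : set 'rV[R]_n.+1) : measurable A ->
  measurable_fun setT (fun t : RR => volume n (slice A t)).
Proof.
move=> /measurable_preimage_rV_cons/(measurable_fun_xsection (volume n)).
by apply: eq_measurable_fun => t _; rewrite sliceE.
Qed.

Lemma lebesgue_rV_slice n (A : set 'rV[R]_n.+1) :
  (volume n.+1 A = \int[mu]_t volume n (slice A t))%E.
Proof. by apply: eq_integral => t _; rewrite sliceE. Qed.

Lemma measurable_cube n N : measurable (cube n N).
Proof.
rewrite (_ : cube n N = \bigcap_(i in [set: 'I_n])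
    (@rV_coord R n i @^-1` `[- N, N])); last first.
  by apply/seteqP; split=> [v Bv i _|v Bv i]; have := Bv i;
    rewrite /= in_itv /rV_coord/= -ler_norml //; apply.
apply: fin_bigcap_measurable => // i _; rewrite -[X in measurable X]setTI.
exact: measurable_rV_coord.
Qed.

Lemma lebesgue_rV_cubeE n N :
  (volume n (cube n N) = \prod_(i < n) mu `[(- N)%R, N]%classic)%E.
Proof.
rewrite -(@lebesgue_rV_box R n (fun=> `[- N, N]%classic))//; congr (volume n _).
by apply/seteqP; split=> v Bv i; have := Bv i; rewrite /= in_itv/= -ler_norml.
Qed.

Lemma lebesgue_rV_cube n N : volume n (cube n N) \is a fin_num.
Proof.
rewrite lebesgue_rV_cubeE; elim/big_ind: _ => //.
  by move=> x y xf yf; rewrite fin_numM.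
by move=> i _; rewrite lebesgue_measure_itv/=; case: ifP.
Qed.

Lemma lebesgue_rV_cube_gt0 n N : 0 < N -> (0 < volume n (cube n N))%E.
Proof.
move=> N0.
rewrite lebesgue_rV_cubeE; elim/big_ind: _ => //.
  by move=> x y x0 y0; rewrite mule_gt0.
move=> i _; rewrite lebesgue_measure_itv/= lte_fin gtrN// -EFinB lte_fin.
by rewrite opprK addr_gt0.
Qed.

Lemma cube_fin_num n N (A : set 'rV[R]_n) : measurable A -> A `<=` cube n N ->
  volume n A \is a fin_num.
Proof.
move=> mA AN; rewrite ge0_fin_numE//.
apply: (@le_lt_trans _ _ (volume n (cube n N))).
  by apply: le_measure; rewrite ?inE//; exact: measurable_cube.
by rewrite -ge0_fin_numE// lebesgue_rV_cube.
Qed.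

Lemma slice_cube n N (A : set 'rV[R]_n.+1) t : A `<=` cube n.+1 N ->
  slice A t `<=` cube n N.
Proof. by move=> AN w /AN /= Nw i; have := Nw (lift ord0 i); rewrite rV_consS. Qed.

Lemma slice_neq0 n N (A : set 'rV[R]_n.+1) t : A `<=` cube n.+1 N ->
  slice A t !=set0 -> `|t| <= N.
Proof. by move=> AN [w /AN /(_ ord0)]; rewrite rV_cons0. Qed.

Lemma rV_cons_lin n (t u : R) (v w : 'rV[R]_n) (x y : R) :
  rV_cons (t * x + u * y, t *: v + u *: w) =
  t *: rV_cons (x : RR, v) + u *: rV_cons (y : RR, w).
Proof.
apply/rowP => i; have [j ->|->] := unliftP ord0 i.
  by rewrite !mxE !liftK /= !mxE.
by rewrite !mxE !unlift_none.
Qed.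

(** The slice volumes [F A], [F B], [F C] satisfy the hypothesis of Prekopa-Leindler by the case of
    dimension [n], and they integrate to the volumes. [C] is any measurable set containing the
    combinations, since a sum of Borel sets need not be Borel. *)
Lemma brunn_minkowski n N l (A B C : set 'rV[R]_n) :
  0 < l < 1 -> measurable A -> measurable B -> measurable C ->
  A `<=` cube n N -> B `<=` cube n N -> C `<=` cube n N ->
  (forall x y, A x -> B y -> C ((1 - l) *: x + l *: y)) ->
  fine (volume n A) `^ (1 - l) * fine (volume n B) `^ l <= fine (volume n C).
Proof.
move=> l01; have /andP[l0 l1] := l01.
elim: n A B C => [|n IHn] A B C mA mB mC AN BN CN ABC.
  (* In dimension 0 the volume tells whether the set contains the only point; an empty set gives 0
     on the left, the exponents being positive. *)
  rewrite !lebesgue_rV0 /=; have l1' : 0 < 1 - l by rewrite subr_gt0.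
  case: (boolP (0 \in A)) => /= [|_]; last by rewrite powR0 ?mul0r ?gt_eqF.
  case: (boolP (0 \in B)) => /= [|_]; last by rewrite (@powR0 _ l) ?mulr0 ?gt_eqF.
  rewrite !inE => B0 A0; rewrite mem_set/=; last first.
    by have := ABC _ _ A0 B0; rewrite !scaler0 addr0.
  by rewrite !powR1 mulr1.
pose F D := fun t : RR => fine (volume n (slice D t)).
have Ffin D : measurable D -> D `<=` cube n.+1 N -> forall t,
    volume n (slice D t) = (F D t)%:E.
  move=> mD DN t; rewrite fineK//; apply: (@cube_fin_num _ N).
    exact: measurable_slice.
  exact: slice_cube.
have mF D : measurable D -> D `<=` cube n.+1 N -> measurable_fun setT (F D).
  move=> mD DN; apply/measurable_EFinP.
  have := measurable_fun_slice mD; apply: eq_measurable_fun => t _ /=.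
  exact: Ffin.
have FE D : measurable D -> D `<=` cube n.+1 N ->
    (\int[mu]_t (F D t)%:E = volume n.+1 D)%E.
  by move=> mD DN; rewrite lebesgue_rV_slice; apply: eq_integral => t _; rewrite Ffin.
have F0 D t : 0 <= F D t by rewrite fine_ge0.
have FN D t : D `<=` cube n.+1 N -> 0 < F D t -> `|t| <= N.
  move=> DN Dt; apply: (slice_neq0 DN); apply/set0P/eqP => D0.
  by move: Dt; rewrite /F D0 measure0 ltxx.
have FK D t : measurable D -> D `<=` cube n.+1 N -> F D t <= fine (volume n (cube n N)).
  move=> mD DN; rewrite -lee_fin -Ffin// fineK ?lebesgue_rV_cube//.
  apply: le_measure; rewrite ?inE; last exact: slice_cube.
    exact: measurable_slice.
  exact: measurable_cube.
have vfin D : measurable D -> D `<=` cube n.+1 N -> volume n.+1 D = (fine (volume n.+1 D))%:E.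
  by move=> mD DN; rewrite fineK//; apply: (cube_fin_num mD DN).
rewrite -lee_fin -(vfin C)// -(FE C)//.
apply: (@prekopa_leindler_line _ l N (fine (volume n (cube n N))) _ _ (F A) (F B)) => //.
- exact: mF.
- exact: mF.
- exact: mF.
- by move=> t; rewrite F0 FK.
- by move=> t; rewrite F0 FK.
- by move=> t; exact: FN.
- by move=> t; exact: FN.
- move=> t u; apply: IHn.
  + exact: measurable_slice.
  + exact: measurable_slice.
  + exact: measurable_slice.
  + exact: slice_cube.
  + exact: slice_cube.
  + exact: slice_cube.
  + by move=> x y Ax By; rewrite /slice /= rV_cons_lin; exact: ABC.
- by rewrite FE// -vfin.
- by rewrite FE// -vfin.
Qed.

Definition homothety n (t : R) (u : 'rV[R]_n) (v : 'rV[R]_n) := t *: v + u.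

Lemma measurable_homothety n t u : measurable_fun setT (@homothety n t u).
Proof.
apply: measurable_fun_rV => i.
under eq_fun do rewrite !mxE.
by apply: measurable_funD => //; apply: measurable_funM => //; exact: measurable_rV_coord.
Qed.

Lemma measurable_preimage_homothety n t u (A : set 'rV[R]_n) :
  measurable A -> measurable (homothety t u @^-1` A).
Proof. by move=> mA; rewrite -[X in measurable X]setTI; exact: measurable_homothety. Qed.

(** Slices of the preimage are preimages of slices: the induction hypothesis contributes [t ^+ n],
    the change of variable on the line one more [t]. *)
Lemma lebesgue_rV_homothety n t u (A : set 'rV[R]_n) : 0 < t -> measurable A ->
  volume n A = ((t ^+ n)%:E * volume n (homothety t u @^-1` A))%E.
Proof.
move=> t0; elim: n u A => [|n IHn] u A mA.
  rewrite expr0 mul1e !lebesgue_rV0; congr ((nat_of_bool _)%:R%:E).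
  have -> : homothety t u @^-1` A = A; last by [].
  by apply/seteqP; split => v; rewrite /= (thinmx0 (homothety _ _ _)) (thinmx0 v).
rewrite !lebesgue_rV_slice.
pose u' := \row_j u 0 (lift ord0 j).
have -> : (\int[mu]_x volume n (slice (homothety t u @^-1` A) x) =
    \int[mu]_x volume n (homothety t u' @^-1` slice A (line_homothety t (u 0%R ord0) x)))%E.
  apply: eq_integral => x _; congr (volume n _).
  apply/seteqP; split => v; rewrite /slice /=;
    rewrite (_ : homothety _ _ _ = rV_cons (line_homothety t (u 0 ord0) x, homothety t u' v)) //;
    apply/rowP => i; (have [j ->|->] := unliftP ord0 i;
      [by rewrite !mxE !liftK /= !mxE | by rewrite !mxE !unlift_none]).
rewrite (ge0_integral_homothety (u 0 ord0) t0)//; last exact: measurable_fun_slice.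
rewrite exprS EFinM -muleA; congr (_ * _)%E.
rewrite -ge0_integralZl_EFin//; last 2 first.
- apply: (eq_measurable_fun (fun x =>
      (t ^- n)%:E * volume n (slice A (line_homothety t (u 0%R ord0) x))))%E.
    move=> x _; rewrite (IHn u') ?muleA -?EFinM ?mulVf ?mul1e//; last exact: measurable_slice.
    by rewrite expf_neq0// gt_eqF.
  apply: emeasurable_funM => //.
  apply: (@measurableT_comp _ _ _ _ _ _ (fun x : RR => volume n (slice A x))) => //.
    exact: measurable_fun_slice.
  exact: measurable_line_homothety.
- by rewrite exprn_ge0// ltW.
by apply: eq_integral => x _; rewrite (IHn u')//; exact: measurable_slice.
Qed.

(** For nonzero [t], the dilate of [A] about [p] with ratio [t], written as the preimage under the
    inverse dilation so that measurability is immediate. *)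
Definition shrink n (A : set 'rV[R]_n) (t : R) (p : 'rV[R]_n) : set 'rV[R]_n :=
  [set y | A (p + t^-1 *: (y - p))].

Lemma shrinkE n (A : set 'rV[R]_n) t p :
  shrink A t p = homothety t^-1 (p - t^-1 *: p) @^-1` A.
Proof.
apply/seteqP; split => y; by rewrite /shrink /homothety /= scalerBr addrCA.
Qed.

Lemma shrink_pointK n (t : R) (p x : 'rV[R]_n) : t != 0 ->
  t *: (p + t^-1 *: (x - p)) + (1 - t) *: p = x.
Proof.
move=> t0; rewrite scalerDr scalerA mulfV// scale1r scalerBl scale1r.
by rewrite [t *: p + _]addrC -addrA [t *: p + _]addrC !subrK.
Qed.

Lemma measurable_shrink n (A : set 'rV[R]_n) t p :
  measurable A -> measurable (shrink A t p).
Proof. by rewrite shrinkE; exact: measurable_preimage_homothety. Qed.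

Lemma lebesgue_rV_shrink n (A : set 'rV[R]_n) t p : 0 < t -> measurable A ->
  volume n (shrink A t p) = ((t ^+ n)%:E * volume n A)%E.
Proof.
move=> t0 mA; rewrite (lebesgue_rV_homothety (p - t *: p) t0 (measurable_shrink t p mA)).
congr (_ * volume n _)%E; rewrite shrinkE; apply/seteqP; split => x;
  rewrite /homothety /= scalerDr scalerA mulVf ?gt_eqF// scale1r scalerBr scalerA mulVf ?gt_eqF//;
  by rewrite scale1r -addrA subrKA subrr addr0.
Qed.

End lebesgue_rV_slices.

Arguments cube {R} n N.

(** * Polyhedra and facet cones *)

Section dot_product.
Context {R : realType} {n : nat}.
Implicit Types (x y z : 'rV[R]_n) (t : R).

Lemma dotpE x y : dotp x y = \sum_j x 0 j * y 0 j.
Proof. by rewrite /dotp mxE; apply: eq_bigr => j _; rewrite mxE. Qed.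

Lemma dotpC x y : dotp x y = dotp y x.
Proof. by rewrite !dotpE; apply: eq_bigr => j _; rewrite mulrC. Qed.

Lemma dotpDr x y z : dotp x (y + z) = dotp x y + dotp x z.
Proof. by rewrite /dotp linearD mulmxDr mxE. Qed.

Lemma dotpZr t x y : dotp x (t *: y) = t * dotp x y.
Proof. by rewrite /dotp linearZ -scalemxAr mxE. Qed.

Lemma dotpDl x y z : dotp (x + y) z = dotp x z + dotp y z.
Proof. by rewrite dotpC dotpDr !(dotpC z). Qed.

Lemma dotpZl t x y : dotp (t *: x) y = t * dotp x y.
Proof. by rewrite dotpC dotpZr dotpC. Qed.

Lemma dotpNr x y : dotp x (- y) = - dotp x y.
Proof. by rewrite -scaleN1r dotpZr mulN1r. Qed.

Lemma dotpNl x y : dotp (- x) y = - dotp x y.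
Proof. by rewrite dotpC dotpNr dotpC. Qed.

Lemma dotpBr x y z : dotp x (y - z) = dotp x y - dotp x z.
Proof. by rewrite dotpDr dotpNr. Qed.

Lemma dotpBl x y z : dotp (x - y) z = dotp x z - dotp y z.
Proof. by rewrite dotpDl dotpNl. Qed.

Lemma dotp0r x : dotp x 0 = 0.
Proof. by rewrite -[0](scale0r 0) dotpZr mul0r. Qed.

Lemma dotp0l x : dotp 0 x = 0.
Proof. by rewrite dotpC dotp0r. Qed.

Lemma dotp_sumr I (r : seq I) (Q : pred I) (F : I -> 'rV[R]_n) x :
  dotp x (\sum_(i <- r | Q i) F i) = \sum_(i <- r | Q i) dotp x (F i).
Proof. exact: (big_morph (dotp x) (dotpDr x) (dotp0r x)). Qed.

Lemma dotp_suml I (r : seq I) (Q : pred I) (F : I -> 'rV[R]_n) x :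
  dotp (\sum_(i <- r | Q i) F i) x = \sum_(i <- r | Q i) dotp (F i) x.
Proof. by rewrite dotpC dotp_sumr; apply: eq_bigr => i _; rewrite dotpC. Qed.

Lemma dotp_self_eq0 x : dotp x x = 0 -> x = 0.
Proof.
rewrite dotpE => /eqP; rewrite psumr_eq0; last by move=> j _; rewrite -expr2 sqr_ge0.
move=> /allP x0; apply/rowP => j; rewrite mxE; apply/eqP.
by have := x0 j (mem_index_enum _); rewrite -expr2 sqrf_eq0.
Qed.

Lemma dotp_inj x y : (forall z, dotp x z = dotp y z) -> x = y.
Proof.
move=> xy; apply/eqP; rewrite -subr_eq0; apply/eqP/dotp_self_eq0.
by rewrite dotpBl xy subrr.
Qed.

Lemma measurable_dotp x : measurable_fun setT (dotp x).
Proof.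
rewrite (_ : dotp x = fun y => \sum_j x 0 j * y 0 j); last first.
  by apply/funext => y; rewrite dotpE.
apply: measurable_sum => j; apply: measurable_funM => //.
exact: measurable_rV_coord.
Qed.

Lemma measurable_dotp_le x t : measurable [set y | dotp x y <= t].
Proof.
rewrite (_ : [set y | _] = (fun y => dotp x y <= t) @^-1` [set true])//.
rewrite -[X in measurable X]setTI; apply: measurable_fun_ler => //.
exact: measurable_dotp.
Qed.

Lemma convex_setP (A : set 'rV[R]_n) : @convex_set R 'rV[R]_n A <->
  forall x y t, A x -> A y -> 0 <= t <= 1 -> A (t *: x + (1 - t) *: y).
Proof.
split=> [cA x y t Ax Ay /andP[t0 t1]|cA x y l].
  have := cA x y (Itv01 t0 t1); rewrite !inE => /(_ Ax Ay).
  by apply.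
by rewrite !inE => Ax Ay; apply: cA => //; apply/andP; split; [exact: ge0|exact: le1].
Qed.

Lemma convex_hull_convex (S : set 'rV[R]_n) : @convex_set R 'rV[R]_n (convex_hull S).
Proof.
apply/convex_setP => x y t Sx Sy t01 A [cA SA].
by move/convex_setP : (cA); apply => //; [exact: Sx|exact: Sy].
Qed.

Lemma convex_hull_sub (S : set 'rV[R]_n) : S `<=` convex_hull S.
Proof. exact: sub_smallest. Qed.

Lemma convex_halfspace x t : @convex_set R 'rV[R]_n [set y | dotp x y <= t].
Proof.
apply/convex_setP => y z s /= yt zt /andP[s0 s1]; rewrite dotpDr !dotpZr.
have -> : t = s * t + (1 - s) * t by rewrite -mulrDl subrKC mul1r.
by rewrite lerD// ler_wpM2l// subr_ge0.
Qed.

End dot_product.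

(** * Bounded polyhedra, their facet cones and caps *)

Section polyhedron.
Context {R : realType} {n m : nat}.
Variable a : 'I_m -> 'rV[R]_n.
Local Notation volume := (lebesgue_rV R n).

Definition polyhedron := [set x | forall i, dotp (a i) x <= 1].
Local Notation P := polyhedron.

Lemma polyhedron0 : P 0.
Proof. by move=> i; rewrite dotp0r. Qed.

Lemma measurable_polyhedron : measurable P.
Proof.
rewrite (_ : P = \bigcap_(i in [set: 'I_m]) [set x | dotp (a i) x <= 1]); last first.
  by apply/seteqP; split=> [v Pv i _|v Pv i]; [exact: Pv|exact: Pv].
by apply: fin_bigcap_measurable => // i _; exact: measurable_dotp_le.
Qed.

Lemma polyhedron_convex x y t : P x -> P y -> 0 <= t <= 1 ->
  P (t *: x + (1 - t) *: y).
Proof.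
move=> Px Py t01 i; have /convex_setP := @convex_halfspace R n (a i) 1; apply => //.
  exact: Px.
exact: Py.
Qed.

Lemma polyhedron_cube_sub : exists2 d : R, 0 < d & cube n d `<=` P.
Proof.
pose S := \sum_i \sum_j `|a i 0 j|.
have S0 : 0 <= S by apply: sumr_ge0 => i _; apply: sumr_ge0.
have S1 : 0 < 1 + S by rewrite ltr_pwDl.
exists (1 + S)^-1; first by rewrite invr_gt0.
move=> x xd i; rewrite dotpE; apply: (@le_trans _ _ (\sum_j `|a i 0 j| * (1 + S)^-1)).
  apply: ler_sum => j _; rewrite (le_trans (ler_norm _))// normrM.
  by rewrite ler_wpM2l//; exact: xd.
rewrite -mulr_suml ler_pdivrMr// mul1r.
rewrite /S (bigD1 i)//=; set T := \sum_(_ | _ != _) _.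
have T0 : 0 <= T by apply: sumr_ge0 => k _; apply: sumr_ge0.
by rewrite addrCA lerDl addr_ge0.
Qed.

Lemma polyhedron_volume_gt0 : (0 < volume P)%E.
Proof.
have [d d0 dP] := polyhedron_cube_sub.
apply: (lt_le_trans (lebesgue_rV_cube_gt0 n d0)).
apply: le_measure; rewrite ?inE//; first exact: measurable_cube.
exact: measurable_polyhedron.
Qed.

Variable N : R.
Hypothesis PN : P `<=` cube n N.

(** All multiples [k *: d] with [k >= 0] lie in [P], which the cube forbids unless [d = 0]. *)
Lemma polyhedron_ray d : (forall i, dotp (a i) d <= 0) -> d = 0.
Proof.
move=> ad; apply/rowP => j; rewrite mxE; apply/eqP; apply/negPn/negP => dj.
have dj0 : 0 < `|d 0 j| by rewrite normr_gt0.
have N0 : 0 <= N by have := PN polyhedron0 j; rewrite mxE normr0.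
have Pkd (k : R) : 0 <= k -> P (k *: d).
  by move=> k0 i; rewrite dotpZr (le_trans _ ler01)// mulr_ge0_le0.
have k0 : 0 <= (N + 1) / `|d 0 j| by rewrite divr_ge0// addr_ge0.
have := PN (Pkd _ k0) j; rewrite mxE normrM ger0_norm// divfK ?gt_eqF//.
by rewrite leNgt ltrDl ltr01.
Qed.

(** The gauge of [P] is the maximum of the [dotp (a j) x], and the cone consists of the points of
    [P] where [i] attains it. A positive value scales [x] onto the facet; the value 0 makes every
    [dotp (a j) x] nonpositive, so [x = 0]. *)
Lemma facet_coneE i : facet_cone P (a i) =
  [set x | 0 <= dotp (a i) x <= 1 /\ forall j, dotp (a j) x <= dotp (a i) x].
Proof.
apply/seteqP; split.
  apply: smallest_sub.
    apply/convex_setP => x y t [/andP[x0 x1] xj] [/andP[y0 y1] yj] /andP[t0 t1].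
    have t1' : 0 <= 1 - t by rewrite subr_ge0.
    split; last first.
      by move=> j; rewrite !dotpDr !dotpZr lerD// ler_wpM2l.
    rewrite dotpDr !dotpZr addr_ge0 ?mulr_ge0//=.
    apply: (@le_trans _ _ (t * 1 + (1 - t) * 1)); last by rewrite !mulr1 subrKC.
    by rewrite lerD// ler_wpM2l.
  move=> x [->|[Px /= ax]].
    by split=> [|j]; rewrite !dotp0r// lexx ler01.
  by split=> [|j]; rewrite ax ?ler01 ?lexx//; exact: Px.
move=> x [/andP[]]; rewrite le_eqVlt => /predU1P[x0 _ xj|x0 x1 xj].
  have -> : x = 0 by apply: polyhedron_ray => j; rewrite x0; exact: xj.
  by apply: convex_hull_sub; left.
have -> : x = dotp (a i) x *: ((dotp (a i) x)^-1 *: x) + (1 - dotp (a i) x) *: 0.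
  by rewrite scaler0 addr0 scalerA mulfV ?gt_eqF// scale1r.
have /convex_setP := @convex_hull_convex R n ([set 0] `|` face_of_normal P (a i)).
apply; last by rewrite ltW.
  apply: convex_hull_sub; right; split => [j|/=]; rewrite dotpZr ?mulVf ?gt_eqF//.
  by rewrite ler_pdivrMl// mulr1.
by apply: convex_hull_sub; left.
Qed.

Lemma measurable_facet_cone i : measurable (facet_cone P (a i)).
Proof.
rewrite facet_coneE.
rewrite (_ : [set x | _] = [set x | dotp (- a i) x <= 0] `&` [set x | dotp (a i) x <= 1] `&`
   \bigcap_(j in [set: 'I_m]) [set x | dotp (a j - a i) x <= 0]); last first.
  apply/seteqP; split=> x /=.
    move=> [/andP[x0 x1] xj]; split; first by rewrite dotpNl oppr_le0.
    by move=> j _ /=; rewrite dotpBl subr_le0.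
  move=> [[]]; rewrite dotpNl oppr_le0 => -> -> xj; split => // j.
  by have := xj j I; rewrite /= dotpBl subr_le0.
apply: measurableI; first by apply: measurableI; exact: measurable_dotp_le.
by apply: fin_bigcap_measurable => // j _; exact: measurable_dotp_le.
Qed.

Lemma facet_cone_sub i : facet_cone P (a i) `<=` P.
Proof. by rewrite facet_coneE => x [/andP[_ x1] xj] j; exact: le_trans (xj j) x1. Qed.

(** Each point lies in the cone of an index that maximises [dotp (a i) x]; subadditivity makes any
    overlap harmless. *)
Lemma polyhedron_cover (i0 : 'I_m) :
  (volume P <= \sum_(i < m) volume (facet_cone P (a i)))%E.
Proof.
apply: (@le_trans _ _ (volume (\big[setU/set0]_(i < m) facet_cone P (a i)))).
  apply: le_measure; rewrite ?inE; first exact: measurable_polyhedron.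
    by apply: bigsetU_measurable => i _; exact: measurable_facet_cone.
  move=> x Px; rewrite -bigcup_seq /=.
  pose i := [arg max_(i > i0) dotp (a i) x]%O.
  have imax j : dotp (a j) x <= dotp (a i) x.
    by rewrite /i; case: Order.TotalTheory.arg_maxP => // k _; exact.
  exists i; first by rewrite /= mem_index_enum.
  rewrite facet_coneE; split=> //; rewrite (Px i) andbT leNgt; apply/negP => ai0.
  have x0 : x = 0 by apply: polyhedron_ray => j; exact: le_trans (imax j) (ltW ai0).
  by move: ai0; rewrite x0 dotp0r ltxx.
have : forall s : seq 'I_m, (volume (\big[setU/set0]_(i <- s) facet_cone P (a i)) <=
   \sum_(i <- s) volume (facet_cone P (a i)))%E; last exact.
elim=> [|i s IHs]; first by rewrite !big_nil measure0.
rewrite !big_cons; apply: (le_trans (measureU2 _ _ _)).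
- exact: measurable_facet_cone.
- by apply: bigsetU_measurable => j _; exact: measurable_facet_cone.
- exact: leeD.
Qed.

Lemma polyhedron_fin : volume P \is a fin_num.
Proof. exact: cube_fin_num measurable_polyhedron PN. Qed.

Lemma facet_cone_fin i : volume (facet_cone P (a i)) \is a fin_num.
Proof.
apply: (cube_fin_num (measurable_facet_cone i) (N := N)).
exact: subset_trans (@facet_cone_sub i) PN.
Qed.

(** The points whose slack [1 - dotp b x] is at least [z]; for [b = a i] the volume is the V(z) of
    the overview. *)
Definition cap b z := P `&` [set x | dotp b x <= 1 - z].

Lemma measurable_cap b z : measurable (cap b z).
Proof.
by apply: measurableI; [exact: measurable_polyhedron|exact: measurable_dotp_le].
Qed.

Lemma cap_cube b z : cap b z `<=` cube n N.
Proof. by move=> x [/PN]. Qed.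

Lemma cap_fin b z : volume (cap b z) \is a fin_num.
Proof. exact: cube_fin_num (measurable_cap b z) (@cap_cube b z). Qed.

(* The cone minus its dilate by [1 - e] lies in the slab that [cap] removes. *)
Lemma cap_slab i e : 0 <= e < 1 ->
  fine (volume (cap (a i) e)) + fine (volume (facet_cone P (a i))) * (1 - (1 - e) ^+ n)
  <= fine (volume P).
Proof.
move=> /andP[e0 e1]; set C := facet_cone P (a i).
have t0 : 0 < 1 - e by rewrite subr_gt0.
have mC : measurable C by exact: measurable_facet_cone.
pose D := homothety (1 - e)^-1 0 @^-1` C.
have mD : measurable D by exact: measurable_preimage_homothety.
have volD : volume D = (((1 - e) ^+ n)%:E * volume C)%E.
  rewrite (lebesgue_rV_homothety 0 t0 mD); congr (_ * volume _)%E.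
  apply/seteqP; split => x; rewrite /D /homothety /= !addr0 scalerA mulVf ?gt_eqF//;
    by rewrite scale1r.
have DC : D `<=` C.
  rewrite /D /C facet_coneE => x; rewrite /homothety /= addr0 !dotpZr => -[/andP[x0 x1] xj].
  move: x0 x1; rewrite pmulr_rge0 ?invr_gt0// => x0; rewrite ler_pdivrMl// mulr1 => x1.
  split; first by rewrite x0 (le_trans x1)// lerBlDr lerDl.
  by move=> j; have := xj j; rewrite !dotpZr ler_pM2l ?invr_gt0.
have Dfin : volume D \is a fin_num by rewrite volD fin_numM// facet_cone_fin.
have volCD : volume (C `\` D) = (volume C - volume D)%E.
  rewrite measureD//; last by rewrite -ge0_fin_numE// facet_cone_fin.
  by congr (_ - volume _)%E; rewrite setIC; apply/setIidPl.
have capCD : cap (a i) e `&` (C `\` D) = set0.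
  apply/seteqP; split => // x [[Px /= xe] [Cx Dx]]; case: Dx; move: Cx.
  rewrite /D /C !facet_coneE /homothety /= addr0 => -[/andP[x0 x1] xj]; split.
    by rewrite dotpZr mulr_ge0 ?invr_ge0 ?(ltW t0)//= ler_pdivrMl// mulr1.
  by move=> j; rewrite !dotpZr ler_pM2l ?invr_gt0.
have : (volume (cap (a i) e) + volume (C `\` D) <= volume P)%E.
  rewrite -measureU//; [|exact: measurable_cap|exact: measurableD].
  apply: le_measure; rewrite ?inE; last by move=> x [[]//|[/facet_cone_sub]].
    by apply: measurableU; [exact: measurable_cap|exact: measurableD].
  exact: measurable_polyhedron.
rewrite volCD volD -(fineK polyhedron_fin) -(fineK (facet_cone_fin i)) -(fineK (cap_fin _ _)).
by rewrite -EFinM -EFinB -EFinD lee_fin mulrBr mulr1 [(1 - e) ^+ n * _]mulrC.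
Qed.

(* Shrinking [P] towards [p] keeps the slack of [b] above [z]. *)
Lemma cap_homothety b p z M : P p -> dotp b p = 1 - M -> 0 <= z < M ->
  (forall x, P x -> dotp b x <= 1) ->
  (1 - z / M) ^+ n * fine (volume P) <= fine (volume (cap b z)).
Proof.
move=> Pp bp /andP[z0 zM] Pb.
have M0 : 0 < M by exact: le_lt_trans z0 zM.
(* At [t *: y + (1 - t) *: p] the slack is at least [(1 - t) * M], which is [z] for this [t]. *)
pose t := 1 - z / M.
have t0 : 0 < t by rewrite subr_gt0 ltr_pdivrMr// mul1r.
have t1 : t <= 1 by rewrite lerBlDr lerDl divr_ge0// ltW.
pose D := shrink P t p.
have mD : measurable D by apply: measurable_shrink measurable_polyhedron.
have volD : volume D = ((t ^+ n)%:E * volume P)%E.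
  exact: lebesgue_rV_shrink measurable_polyhedron.
have Dcap : D `<=` cap b z.
  move=> x; rewrite /D /shrink /=; set y := _ + _ => Py.
  have xy : x = t *: y + (1 - t) *: p.
    by rewrite shrink_pointK// gt_eqF.
  split.
    by rewrite xy; apply: polyhedron_convex => //; rewrite (ltW t0).
  rewrite /= xy dotpDr !dotpZr bp.
  have -> : 1 - z = t * 1 + (1 - t) * (1 - M) by rewrite /t; field; rewrite gt_eqF.
  by rewrite lerD2r ler_wpM2l ?(ltW t0)//; exact: Pb.
have : (volume D <= volume (cap b z))%E.
  by apply: le_measure; rewrite ?inE//; exact: measurable_cap.
by rewrite volD -(fineK polyhedron_fin) -(fineK (cap_fin _ _)) -EFinM lee_fin.
Qed.

End polyhedron.

(** * The facet cone inequality *)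

Section real_lemmas.
Context {R : realType}.
Implicit Types (u x K : R).

Lemma exprD1_second_order n u : exists2 K, 0 <= K &
  forall x, 0 <= x <= 1 -> (1 + x * u) ^+ n <= 1 + n%:R * (x * u) + K * x ^+ 2.
Proof.
(* The induction needs the two-sided bound: the error gets multiplied by [1 + x * u], whose sign is
   unknown. *)
suff [K K0 H] : exists2 K, 0 <= K &
    forall x, 0 <= x <= 1 -> `|(1 + x * u) ^+ n - 1 - n%:R * (x * u)| <= K * x ^+ 2.
  exists K => // x /H; rewrite ler_norml => /andP[_]; lra.
elim: n => [|n [K K0 IHn]].
  by exists 0 => // x _; rewrite expr0 subrr mul0r subrr normr0 mul0r.
exists ((1 + `|u|) * K + n%:R * u ^+ 2).
  by rewrite addr_ge0// mulr_ge0// ?sqr_ge0// addr_ge0.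
move=> x /[dup] x01 /andP[x0 x1].
have -> : (1 + x * u) ^+ n.+1 - 1 - n.+1%:R * (x * u) =
    (1 + x * u) * ((1 + x * u) ^+ n - 1 - n%:R * (x * u)) + n%:R * u ^+ 2 * x ^+ 2.
  by rewrite exprS -natr1; ring.
apply: (le_trans (ler_normD _ _)); rewrite [leRHS]mulrDl lerD//; last first.
  by rewrite ger0_norm//; apply: mulr_ge0; [apply: mulr_ge0|]; rewrite ?sqr_ge0.
rewrite normrM -mulrA ler_pM//; last exact: IHn.
rewrite (le_trans (ler_normD _ _))// normr1 lerD2l normrM ger0_norm//.
by rewrite ler_piMl.
Qed.

Lemma ler_of_small_slack (L D K l0 : R) : 0 < l0 -> 0 <= K ->
  (forall l, 0 < l < l0 -> L * l <= D * l + K * l ^+ 2) -> L <= D.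
Proof.
move=> l00 K0 H; rewrite leNgt; apply/negP => DL.
(* For this [l] the term [K * l] is at most half of the gap [L - D]; [K + 1] avoids a zero
   denominator. *)
pose l := Num.min (l0 / 2) ((L - D) / (2 * (K + 1))).
have K1 : 0 < K + 1 by rewrite ltr_wpDl.
have l0' : 0 < l by rewrite lt_min divr_gt0//= divr_gt0// ?subr_gt0// mulr_gt0.
have ll0 : l < l0 by rewrite gt_min ltr_pdivrMr// ltr_pMr// ltr1n.
have : L * l <= D * l + K * l ^+ 2 by apply: H; rewrite l0'.
rewrite expr2 mulrA -mulrDl ler_pM2r// => LDK.
have : l <= (L - D) / (2 * (K + 1)) by rewrite ge_min lexx orbT.
rewrite ler_pdivlMr ?mulr_gt0// => h.
have : K * l <= K * l by [].
nra.
Qed.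

Lemma integral_deriv_poly (p : {poly R}) (a b : R) : a < b ->
  (\int[@lebesgue_measure R]_(x in `[a, b]) (p^`().[x])%:E = (p.[b])%:E - (p.[a])%:E)%E.
Proof.
move=> ab; apply: (@continuous_FTC2 R (horner p^`()) (horner p)) => //.
- by apply: continuous_subspaceT => x; exact: continuous_horner.
- split=> [x _| |].
  + exact: derivable_horner.
  + by apply: cvg_at_right_filter; exact: continuous_horner.
  + by apply: cvg_at_left_filter; exact: continuous_horner.
- by move=> x _; rewrite derivE.
Qed.

Lemma integral_power_decay n (k M : R) : 0 < k -> 0 < M ->
  (\int[@lebesgue_measure R]_(x in `[0%R, M]) ((1 - k * x) ^+ n)%:E =
   ((1 - (1 - k * M) ^+ n.+1) / (k * n.+1%:R))%:E)%E.
Proof.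
move=> k0 M0.
have n1 : n.+1%:R != 0 :> R by rewrite pnatr_eq0.
pose p := (- (k * n.+1%:R)^-1) *: ((1 - k *: 'X) ^+ n.+1) : {poly R}.
have pE x : p.[x] = - (k * n.+1%:R)^-1 * (1 - k * x) ^+ n.+1.
  by rewrite /p hornerZ horner_exp !hornerE.
have p'E x : p^`().[x] = (1 - k * x) ^+ n.
  rewrite /p derivZ deriv_exp derivB derivZ derivX derivC sub0r /=.
  rewrite hornerZ hornerMn hornerM horner_exp !hornerE -[X in _ * X = _]mulr_natr.
  by move: (n.+1%:R : R) n1 => s s0; field; rewrite s0 gt_eqF.
transitivity (\int[@lebesgue_measure R]_(x in `[0%R, M]) (p^`().[x])%:E)%E.
  by apply: eq_integral => x _; rewrite p'E.
rewrite integral_deriv_poly// !pE -EFinB; congr EFin.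
rewrite mulr0 subr0 expr1n; move: (n.+1%:R : R) (_ ^+ n.+1) n1 => s t s0.
by field; rewrite s0 gt_eqF.
Qed.

End real_lemmas.

Section facet_inequality.
Context {R : realType} {n m : nat}.
Variables (a : 'I_m -> 'rV[R]_n) (N : R).
Local Notation volume := (lebesgue_rV R n).
Local Notation P := (polyhedron a).
Hypothesis PN : P `<=` cube n N.
Hypothesis n_gt0 : (0 < n)%N.
Variable i : 'I_m.
Local Notation V z := (fine (volume (cap a (a i) z))).
Local Notation v := (fine (volume P)).
Local Notation c := (fine (volume (facet_cone P (a i)))).

Let v_gt0 : 0 < v.
Proof.
rewrite fine_gt0// polyhedron_volume_gt0/=.
by rewrite -ge0_fin_numE//; exact: polyhedron_fin PN.
Qed.

Let c_ge0 : 0 <= c. Proof. exact: fine_ge0. Qed.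

Let c_le : c <= v.
Proof.
rewrite fine_le ?(polyhedron_fin PN) ?(facet_cone_fin PN)//.
apply: le_measure; rewrite ?inE.
- exact: (measurable_facet_cone PN).
- exact: measurable_polyhedron.
- exact: (facet_cone_sub PN).
Qed.

(* First-order expansion as [l] tends to 0 of Brunn-Minkowski for
   [(1 - l) P + l r (cap z)], which lies in [mu (cap (l r z / mu))] with
   [mu = 1 - l + l r]; [cap_bound] then takes the best [r]. *)
Lemma cap_log_bound z r : 0 < z -> 0 < V z -> 0 < r ->
  ln (r ^+ n * (V z / v)) <= n%:R * (r - 1) - c / v * (n%:R * (r * z)).
Proof.
move=> z0 Vz0 r0.
set k := c / v; set L := ln _.
have k0 : 0 <= k by rewrite divr_ge0// ltW.
have k1 : k <= 1 by rewrite ler_pdivrMr// mul1r.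
have X0 : 0 < r ^+ n * (V z / v) by rewrite mulr_gt0 ?exprn_gt0// divr_gt0.
have [K1 K10 HK1] := exprD1_second_order n (r - 1).
have [K2 K20 HK2] := exprD1_second_order n (r - 1 - r * z).
(* Below this threshold both [l] and the slack [e] defined below are less than 1. *)
have l00 : 0 < (1 + r * z)^-1 by rewrite invr_gt0 ltr_pwDl// mulr_ge0// ltW.
apply: (ler_of_small_slack l00 (addr_ge0 K10 K20)) => l /andP[l0 ll].
have lrz : l * (1 + r * z) < 1.
  by move: ll; rewrite -[X in _ < X]mul1r ltr_pdivlMr// ltr_pwDl// mulr_ge0// ltW.
have rz0 : 0 < r * z by rewrite mulr_gt0.
have lrz0 : 0 < l * (r * z) by rewrite mulr_gt0.
have l1 : l < 1 by move: lrz; rewrite mulrDr mulr1; lra.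
have l01 : 0 <= l <= 1 by rewrite !ltW.
pose mu := 1 + l * (r - 1).
have lr0 : 0 < l * r by rewrite mulr_gt0.
have mu0 : 0 < mu by rewrite /mu mulrBr mulr1; lra.
pose e := l * (r * z) / mu.
have e0 : 0 <= e by rewrite divr_ge0// ltW.
have e1 : e < 1 by rewrite ltr_pdivrMr// mul1r /mu; move: lrz; rewrite !mulrDr; lra.
pose B := homothety r^-1 0 @^-1` cap a (a i) z.
pose C := homothety mu^-1 0 @^-1` cap a (a i) e.
have mB : measurable B by apply: measurable_preimage_homothety (measurable_cap _ _ _).
have mC : measurable C by apply: measurable_preimage_homothety (measurable_cap _ _ _).
have volH (t w : R) : 0 < t ->
    fine (volume (homothety t^-1 0 @^-1` cap a (a i) w)) = t ^+ n * V w.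
  move=> t0; rewrite (lebesgue_rV_homothety 0 t0); last first.
    exact: measurable_preimage_homothety (measurable_cap _ _ _).
  rewrite (_ : _ @^-1` _ = cap a (a i) w) ?fineM ?(cap_fin PN)//.
  apply/seteqP; split => x; rewrite /homothety /= !addr0 scalerA mulVf ?gt_eqF//;
    by rewrite scale1r.
have cubeH (t w : R) : 0 < t -> t <= 1 + r ->
    homothety t^-1 0 @^-1` cap a (a i) w `<=` cube n (N * (1 + r)).
  move=> t0 tr x; rewrite /homothety /= addr0 => /(cap_cube PN) xN j.
  have := xN j; rewrite mxE normrM gtr0_norm ?invr_gt0// ler_pdivrMl// => /le_trans; apply.
  rewrite mulrC ler_wpM2l//.
  by apply: le_trans (PN (polyhedron0 a) j); rewrite mxE normr0.
have := @brunn_minkowski R n (N * (1 + r)) l P B C.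
rewrite l0 l1 => /(_ isT (measurable_polyhedron a) mB mC).
have PN' : P `<=` cube n (N * (1 + r)).
  move=> x /PN xN j; apply: (le_trans (xN j)); rewrite ler_peMr ?lerDl ?(ltW r0)//.
  exact: le_trans (xN j).
have BN : B `<=` cube n (N * (1 + r)) by apply: cubeH => //; rewrite lerDr.
have CN : C `<=` cube n (N * (1 + r)).
  apply: cubeH => //; rewrite /mu lerD2l mulrBr mulr1.
  have : l * r <= 1 * r by rewrite ler_wpM2r// ltW.
  by lra.
move=> /(_ PN' BN CN).
rewrite !volH// => H.
have {H} : v `^ (1 - l) * (r ^+ n * V z) `^ l <= mu ^+ n * V e.
  apply: H => x y Px; rewrite /B /C /homothety /= !addr0 => -[Py yz].
  (* The weights [1 - l] and [l * r] of [x] and [r^-1 *: y] add up to [mu], so this is a convex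
     combination of two points of [P]. *)
  have -> : mu^-1 *: ((1 - l) *: x + l *: y) =
      ((1 - l) / mu) *: x + (1 - (1 - l) / mu) *: (r^-1 *: y).
    rewrite scalerDr !scalerA mulrC; congr (_ + _ *: _).
    by rewrite /mu; field; rewrite !gt_eqF.
  split.
    apply: polyhedron_convex => //.
    rewrite divr_ge0 ?(ltW mu0) ?subr_ge0 ?(ltW l1)//= ler_pdivrMr// mul1r /mu mulrBr mulr1.
    by lra.
  rewrite /= dotpDr [dotp (a i) (_ *: x)]dotpZr [dotp (a i) (_ *: (_ *: y))]dotpZr.
  have mul : 1 - (1 - l) / mu = l * r / mu by rewrite /mu; field; rewrite gt_eqF.
  rewrite mul -lerBrDl.
  apply: (@le_trans _ _ (l * r / mu * (1 - z))).
    by rewrite ler_wpM2l// divr_ge0// ltW.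
  rewrite lerBrDl.
  have -> : 1 - e = (1 - l) / mu * 1 + l * r / mu * (1 - z).
    by rewrite /e /mu; field; rewrite gt_eqF.
  by rewrite lerD2r ler_wpM2l ?divr_ge0 ?subr_ge0 ?(ltW l1) ?(ltW mu0)//; exact: Px.
have -> : v `^ (1 - l) * (r ^+ n * V z) `^ l = v * expR (l * L).
  rewrite -[X in (X * _) `^ l]mul1r.
  rewrite (_ : 1 * r ^+ n * V z = v * (r ^+ n * (V z / v))); last by field; rewrite gt_eqF.
  rewrite powRM ?(ltW v_gt0) ?(ltW X0)// mulrA -powRD; last by rewrite subrK oner_eq0.
  by rewrite subrK powRr1 ?(ltW v_gt0)// /powR gt_eqF.
have := cap_slab PN i (e := e); rewrite e0 e1 => /(_ isT) slab vle.
have emu : mu * (1 - e) = 1 + l * (r - 1 - r * z).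
  by rewrite /e /mu; field; rewrite gt_eqF.
have mun0 : 0 <= mu ^+ n by rewrite exprn_ge0// ltW.
have {}vle : v * expR (l * L) <= mu ^+ n * (v - c) + c * (1 + l * (r - 1 - r * z)) ^+ n.
  apply: (le_trans vle); rewrite -emu exprMn.
  have : mu ^+ n * V e <= mu ^+ n * (v - c * (1 - (1 - e) ^+ n)).
    by rewrite ler_wpM2l// lerBrDr.
  by lra.
(* Both powers have bases affine in [l]; the coefficient of [l] on the right is
   [n%:R * (r - 1) - k * (n%:R * (r * z))], the desired bound on [L]. *)
have {}vle : expR (l * L) <= (1 - k) * mu ^+ n + k * (1 + l * (r - 1 - r * z)) ^+ n.
  rewrite -(ler_pM2l v_gt0); apply: (le_trans vle).
  rewrite le_eqVlt; apply/orP; left; apply/eqP; rewrite /k.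
  by field; rewrite gt_eqF.
have := expR_ge1Dx (l * L).
have h1 : (1 - k) * mu ^+ n <= (1 - k) * (1 + n%:R * (l * (r - 1)) + K1 * l ^+ 2).
  by rewrite ler_wpM2l ?subr_ge0//; exact: HK1.
have h2 : k * (1 + l * (r - 1 - r * z)) ^+ n <=
    k * (1 + n%:R * (l * (r - 1 - r * z)) + K2 * l ^+ 2).
  by rewrite ler_wpM2l//; exact: HK2.
have h3 : (1 - k) * K1 * l ^+ 2 <= K1 * l ^+ 2.
  by rewrite ler_wpM2r ?sqr_ge0// ler_piMl// lerBlDr lerDl.
have h4 : k * K2 * l ^+ 2 <= K2 * l ^+ 2.
  by rewrite ler_wpM2r ?sqr_ge0// ler_piMl.
by lra.
Qed.

Lemma cap_bound z : 0 < z -> 0 < V z ->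
  0 < 1 - c / v * z /\ V z <= v * (1 - c / v * z) ^+ n.
Proof.
move=> z0 Vz0; set k := c / v; set w := V z / v.
have w0 : 0 < w by rewrite divr_gt0.
have H r : 0 < r -> n%:R * ln r + ln w <= n%:R * (r * (1 - k * z) - 1).
  move=> r0; have := cap_log_bound z0 Vz0 r0.
  rewrite lnM ?posrE ?exprn_gt0// lnXn// -mulr_natl -/k; lra.
have n0 : 0 < n%:R :> R by rewrite ltr0n.
have q0 : 0 < 1 - k * z.
  rewrite ltNge; apply/negP => q0.
  (* This [r] is [w] to the power -1/n and makes the left side 0, so [r * (1 - k * z) >= 1]. *)
  have := H _ (expR_gt0 (- (ln w) / n%:R)).
  rewrite expRK mulrC divfK ?gt_eqF// addNr pmulr_rge0// subr_ge0.
  rewrite leNgt (le_lt_trans _ ltr01)// pmulr_rle0// expR_gt0.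
split => //.
(* The minimiser of [n%:R * (r * (1 - k * z) - 1) - n%:R * ln r]. *)
have := H (1 - k * z)^-1; rewrite invr_gt0 => /(_ q0).
rewrite mulVf ?gt_eqF// subrr mulr0 lnV ?posrE// mulrN addrC subr_le0.
rewrite mulr_natl -lnXn// ler_ln ?posrE ?exprn_gt0//.
by rewrite /w ler_pdivrMr// mulrC.
Qed.

(** The slack has integral [v] and maximum [M], so the layer-cake formula and [cap_bound] give [k *
    (n%:R + 1) <= 1 - (1 - k * M) ^+ n.+1]. The power is nonnegative; dropping it gives the
    inequality, while equality makes it vanish, that is, [M = k^-1 = n%:R + 1]. *)
Lemma facet_inequality p M : P p -> dotp (a i) p = 1 - M ->
  (forall x, P x -> 1 - M <= dotp (a i) x) ->
  (\int[volume]_(x in P) (1 - dotp (a i) x)%:E = volume P)%E ->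
  c * (n%:R + 1) <= v /\ (c * (n%:R + 1) = v -> M = n%:R + 1).
Proof.
move=> Pp pM PM intP; set k := c / v.
have M0 : 0 < M by have := PM _ (polyhedron0 a); rewrite dotp0r; lra.
have Pa x : P x -> dotp (a i) x <= 1 by apply.
have Vpos z : 0 <= z < M -> 0 < V z.
  move=> /andP[z0 zM]; apply: lt_le_trans (cap_homothety PN Pp pM _ Pa); last by rewrite z0.
  by rewrite mulr_gt0// exprn_gt0// subr_gt0 ltr_pdivrMr// mul1r.
have cE : c = k * v by rewrite divfK// gt_eqF.
have n1 : 0 < n%:R + 1 :> R by rewrite ltr_wpDl.
(* If [c = 0], division by [k] is impossible, but equality fails because [v > 0]. *)
have [k0|k0] := leP k 0.
  have c0 : c = 0 by apply/eqP; rewrite eq_le c_ge0 andbT cE pmulr_lle0.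
  rewrite c0 mul0r; split; first exact: ltW.
  by move=> v0; move: v_gt0; rewrite -v0 ltxx.
(* Otherwise the cap at level [k^-1 < M] has positive volume, and [cap_bound] would require
   [1 - k * k^-1 > 0]. *)
have kM : k * M <= 1.
  rewrite leNgt; apply/negP => kM.
  have z0 : 0 < k^-1 by rewrite invr_gt0.
  have zM : k^-1 < M by rewrite -[_^-1]mul1r ltr_pdivrMr// mulrC.
  have := cap_bound z0; rewrite Vpos ?(ltW z0)// => /(_ isT) [].
  by rewrite -/k mulfV ?gt_eqF// subrr ltxx.
pose f := (fun x => 1 - dotp (a i) x) \_ P.
have mP := measurable_polyhedron a.
have mf : measurable_fun setT f.
  apply/(measurable_restrictT _ mP)/measurable_funTS.
  by apply: measurable_funB => //; exact: measurable_dotp.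
have f0 x : 0 <= f x.
  by rewrite /f patchE; case: ifPn => //; rewrite inE => /Pa; rewrite subr_ge0.
have fE r : 0 <= r -> [set x | r < f x] = P `&` [set x | dotp (a i) x < 1 - r].
  move=> r0; apply/seteqP; split => x /=; rewrite /f patchE.
    case: ifPn => [|_]; last by rewrite ltNge r0.
    by rewrite inE => Px rx; split => //; lra.
  by move=> [Px rx]; rewrite mem_set//; lra.
have fM r : M <= r -> [set x | r < f x] = set0.
  move=> Mr; rewrite fE; last exact: le_trans (ltW M0) Mr.
  by apply/seteqP; split => // x [/PM] /=; lra.
have : (volume P <= v%:E * \int[@lebesgue_measure R]_(r in `[0%R, M]) ((1 - k * r) ^+ n)%:E)%E.
  rewrite -{1}intP.
  have -> : (\int[volume]_(x in P) (1 - dotp (a i) x)%:E = \int[volume]_x (f x)%:E)%E.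
    by rewrite integral_mkcond; apply: eq_integral => x _; rewrite /f !patchE; case: ifP.
  rewrite layer_cake//.
  have -> : (\int[@lebesgue_measure R]_(r in `[0%R, +oo[) volume [set x | (r < f x)%R] =
      \int[@lebesgue_measure R]_(r in `[0%R, M]) volume [set x | (r < f x)%R])%E.
    rewrite integral_mkcond [RHS]integral_mkcond; apply: eq_integral => r _.
    rewrite !patchE !mem_setE !in_itv/= andbT.
    have [r0|] //= := boolP (0 <= r).
    by case: leP => // /ltW /fM ->; rewrite measure0.
  have k1 r : r <= M -> 0 <= 1 - k * r.
    by move=> rM; rewrite subr_ge0 (le_trans _ kM)// ler_pM2l.
  have mpow D : measurable_fun D (fun r : measurableTypeR R => ((1 - k * r) ^+ n)%:E).
    apply/measurable_EFinP; apply: measurable_funX; apply: measurable_funB => //.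
  rewrite -ge0_integralZl_EFin//; last 2 first.
  - by move=> r /=; rewrite in_itv/= => /andP[_ /k1 rM]; rewrite lee_fin exprn_ge0.
  - exact: ltW.
  apply: ge0_le_integral => //.
  - by apply: measurable_funTS; exact: measurable_fun_superlevel.
  - by apply: emeasurable_funM => //; exact: mpow.
  move=> r /=; rewrite in_itv/= => /andP[r0 rM].
  rewrite -EFinM.
  (* The end points are separate: [cap_bound] needs [0 < r] and a cap of positive volume, known only
     for [r < M]. *)
  have [->|rN0] := eqVneq r 0.
    rewrite mulr0 subr0 expr1n mulr1 fE// fineK ?(polyhedron_fin PN)//.
    apply: le_measure; [|by rewrite inE|by move=> x []].
    by rewrite inE -fE//; exact: measurable_superlevel.
  have [MrE|rNM] := eqVneq r M.
    by rewrite fM ?MrE// measure0 lee_fin mulr_ge0 ?exprn_ge0 ?k1// ltW.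
  have r0' : 0 < r by rewrite lt_neqAle eq_sym rN0.
  have rM' : 0 <= r < M by rewrite r0 lt_neqAle rNM.
  have [_ Vr] := cap_bound r0' (Vpos r rM').
  apply: (@le_trans _ _ (volume (cap a (a i) r))).
    apply: le_measure; rewrite ?inE//.
    - exact: measurable_superlevel.
    - exact: measurable_cap.
    - by rewrite fE// => x [Px /ltW].
  by rewrite -(fineK (cap_fin PN _ _)) lee_fin.
rewrite integral_power_decay// -[X in (X <= _)%E](fineK (polyhedron_fin PN)) -EFinM lee_fin.
rewrite -[n.+1%:R]natr1 => vle.
have kn0 : 0 < k * (n%:R + 1) by exact: mulr_gt0.
have kn : k * (n%:R + 1) <= 1 - (1 - k * M) ^+ n.+1.
  by rewrite -[leLHS]mul1r -ler_pdivlMr// -(ler_pM2l v_gt0) mulr1.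
have cn : c * (n%:R + 1) = k * (n%:R + 1) * v by rewrite cE; ring.
have qM : 0 <= (1 - k * M) ^+ n.+1 by rewrite exprn_ge0// subr_ge0.
split; first by rewrite cn ler_piMl ?(ltW v_gt0)//; lra.
rewrite cn -[RHS]mul1r => /(mulIf (lt0r_neq0 v_gt0)) kn1.
have /eqP : (1 - k * M) ^+ n.+1 = 0 by apply/eqP; rewrite eq_le qM andbT; lra.
rewrite expf_eq0/= subr_eq0 => /eqP kM1.
have : k * M = k * (n%:R + 1) by rewrite -kM1.
by move/(mulfI (lt0r_neq0 k0)).
Qed.

End facet_inequality.

Section centered_polyhedron.
Context {R : realType} {n m : nat}.
Variables (a : 'I_m -> 'rV[R]_n) (N : R).
Local Notation volume := (lebesgue_rV R n).
Local Notation P := (polyhedron a).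
Hypothesis PN : P `<=` cube n N.

Lemma centered_slack b : centered P ->
  (\int[volume]_(x in P) (1 - dotp b x)%:E = volume P)%E.
Proof.
move=> cP.
have mP := measurable_polyhedron a.
have Pfin : (volume P < +oo)%E by rewrite -ge0_fin_numE//; exact: polyhedron_fin PN.
have v0 : 0 < fine (volume P) by rewrite fine_gt0// polyhedron_volume_gt0.
have icoord j : volume.-integrable P (EFin \o (fun x : 'rV[R]_n => x 0 j)).
  apply: measurable_bounded_integrable => //.
    by apply: measurable_funTS; exact: measurable_rV_coord.
  exists N; split; first exact: num_real.
  by move=> K NK x Px; apply: (le_trans (PN Px j)); exact: ltW.
(* Positive volume removes the factor in the centroid; integrability turns its real-valued integral
   back into the extended one. *)
have coord0 j : (\int[volume]_(x in P) (x 0 j)%:E = 0)%E.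
  have /rowP/(_ j) := cP; rewrite !mxE => /eqP.
  rewrite mulf_eq0 invr_eq0 gt_eqF//= => /eqP cj.
  rewrite -(fineK (integrable_fin_num mP (icoord j))).
  by rewrite [fine _]cj.
have idot : volume.-integrable P (EFin \o (dotp b)).
  have -> : EFin \o dotp b = (fun x : 'rV[R]_n => \sum_j (b 0 j)%:E * (x 0 j)%:E)%E.
    by apply/funext => x; rewrite /= dotpE -sumEFin.
  by apply: integrable_sum => // j _; apply: integrableZl => //; exact: icoord.
rewrite (@integralB_EFin _ _ _ _ _ (cst 1) (dotp b))//; last first.
  apply: measurable_bounded_integrable => //.
  by exists 1; split => // K K1 x _; rewrite /= normr1 ltW.
rewrite [X in (_ - X)%E](_ : _ = 0%E).
  by rewrite sube0 (integral_cst _ mP 1%:E)// mul1e.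
have -> : (\int[volume]_(x in P) (dotp b x)%:E =
    \int[volume]_(x in P) (\sum_j (b 0 j)%:E * (x 0 j)%:E))%E.
  by apply: eq_integral => x _; rewrite dotpE -sumEFin.
rewrite integral_sum//; last by move=> j; apply: integrableZl => //; exact: icoord.
by rewrite big1// => j _; rewrite (integralZl mP (icoord j)) coord0 mule0.
Qed.

End centered_polyhedron.

(** * Equality forces a pyramid *)

Section pyramid.
Context {R : realType} {n m : nat}.
Variables (a : 'I_m -> 'rV[R]_n) (N : R).
Local Notation volume := (lebesgue_rV R n).
Local Notation P := (polyhedron a).
Hypothesis PN : P `<=` cube n N.
Hypothesis n_gt0 : (0 < n)%N.
Variable i : 'I_m.
Local Notation v := (fine (volume P)).
Local Notation c := (fine (volume (facet_cone P (a i)))).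

Lemma cube_dotp_ge (b x : 'rV[R]_n) : cube n N x -> - (N * \sum_j `|b 0 j|) <= dotp b x.
Proof.
move=> xN; rewrite lerNl dotpE -sumrN mulr_sumr; apply: ler_sum => j _.
by rewrite (le_trans (ler_norm _))// normrN normrM mulrC ler_wpM2r.
Qed.

(* Both sides of the inclusion of the dilate of [P] about [p] in [cap] have the
   same volume; a point of [cap] outside the dilate would have a small copy of
   [cap] around it outside the dilate as well. *)
Lemma pyramid_of_equality p x : P p -> dotp (a i) p = - n%:R ->
  c * (n%:R + 1) = v -> P x -> - n%:R < dotp (a i) x ->
  P (p + (1 - (1 - dotp (a i) x) / (n%:R + 1))^-1 *: (x - p)).
Proof.
move=> Pp pi cv Px xi.
set z := 1 - dotp (a i) x; set H := n%:R + 1; set t := 1 - z / H.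
have H0 : 0 < H by rewrite ltr_wpDl.
have z0 : 0 <= z by rewrite subr_ge0; exact: Px.
have zH : z < H by rewrite /z /H; lra.
have t0 : 0 < t by rewrite subr_gt0 ltr_pdivrMr// mul1r.
have [z0'|zN0] := eqVneq z 0.
  by rewrite /t z0' mul0r subr0 invr1 scale1r addrC subrK.
have zp : 0 < z by rewrite lt_neqAle eq_sym zN0.
have v0 : 0 < v.
  rewrite fine_gt0// polyhedron_volume_gt0/= -ge0_fin_numE//; exact: polyhedron_fin PN.
have k : c / v = H^-1.
  have c0 : c != 0 by apply/eqP => c0; move: v0; rewrite -cv c0 mul0r ltxx.
  by rewrite -cv invfM mulrA mulfV// mul1r.
have Dcap : (t ^+ n) * v <= fine (volume (cap a (a i) z)).
  have pH : dotp (a i) p = 1 - H by rewrite pi /H; lra.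
  by apply: (cap_homothety PN Pp pH) => [|y Py]; [rewrite z0|exact: Py].
have Vz0 : 0 < fine (volume (cap a (a i) z)).
  by apply: lt_le_trans Dcap; rewrite mulr_gt0// exprn_gt0.
have [_] := cap_bound PN n_gt0 zp Vz0.
rewrite k [H^-1 * z]mulrC -/t => Vz j; rewrite leNgt; apply/negP => fj.
set f := p + t^-1 *: (x - p) in fj.
(* On [P] the values of [dotp (a j)] lie between [1 - B] and 1, so they drop by at most [B] from one
   point of [P] to another. *)
pose B := N * \sum_l `|a j 0 l| + 1.
have N0 : 0 <= N.
  by apply: le_trans (PN (polyhedron0 a) (Ordinal n_gt0)); rewrite mxE normr0.
have B0 : 0 < B by rewrite ltr_wpDl// mulr_ge0// sumr_ge0.
(* Small enough that, after the inverse dilation about [p], the copy of ratio [e] around [x] keeps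
   [dotp (a j)] above 1: the drop [t^-1 * e * B] is less than the excess at [f]. *)
pose e := Num.min 1 (t * (dotp (a j) f - 1) / (2 * B)).
have e0 : 0 < e by rewrite lt_min ltr01/= divr_gt0// ?mulr_gt0// subr_gt0.
have e1 : e <= 1 by rewrite ge_min lexx.
have eB : t^-1 * e * B < dotp (a j) f - 1.
  have : e <= t * (dotp (a j) f - 1) / (2 * B) by rewrite ge_min lexx orbT.
  rewrite ler_pdivlMr ?mulr_gt0// => h.
  rewrite -mulrA ltr_pdivrMl//.
  have : 0 < t * (dotp (a j) f - 1) by rewrite mulr_gt0// subr_gt0.
  by move: h; rewrite mulrCA; lra.
pose D := shrink P t p; pose E := shrink (cap a (a i) z) e x.
have mcap : measurable (cap a (a i) z) by exact: measurable_cap.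
have mD : measurable D by apply: measurable_shrink (measurable_polyhedron a).
have mE : measurable E by exact: measurable_shrink.
have toe y : y = e *: (x + e^-1 *: (y - x)) + (1 - e) *: x.
  by rewrite shrink_pointK// gt_eqF.
have tot y : y = t *: (p + t^-1 *: (y - p)) + (1 - t) *: p.
  by rewrite shrink_pointK// gt_eqF.
have t1 : t <= 1 by rewrite lerBlDr lerDl divr_ge0// ltW.
have Ecap : E `<=` cap a (a i) z.
  move=> y [Py /= yz]; rewrite [y]toe; split.
    by apply: polyhedron_convex => //; rewrite (ltW e0).
  rewrite /= dotpDr [dotp _ (e *: _)]dotpZr [dotp _ ((1 - e) *: _)]dotpZr.
  have -> : 1 - z = e * (1 - z) + (1 - e) * (1 - z) by ring.
  rewrite lerD// ?ler_wpM2l// ?subr_ge0// ?(ltW e0)//.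
  by rewrite /z; lra.
have Dcap' : D `<=` cap a (a i) z.
  move=> y Py; rewrite [y]tot; split.
    by apply: polyhedron_convex => //; rewrite (ltW t0).
  rewrite /= dotpDr [dotp _ (t *: _)]dotpZr [dotp _ ((1 - t) *: _)]dotpZr pi.
  have -> : 1 - z = t * 1 + (1 - t) * - n%:R by rewrite /t /H; field; rewrite gt_eqF.
  by rewrite lerD2r ler_wpM2l ?(ltW t0)//; exact: Py.
have DE : D `&` E = set0.
  apply/seteqP; split => // y [/(_ j) Dy [/PN/(@cube_dotp_ge (a j)) Ey _]].
  move: Dy; apply/negP; rewrite -ltNge.
  set w := x + _ in Ey.
  have -> : p + t^-1 *: (y - p) = f + (t^-1 * e) *: (w - x).
    have -> : w - x = e^-1 *: (y - x) by rewrite /w addrC addKr.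
    rewrite /f scalerA mulfK ?gt_eqF//.
    by rewrite -addrA -scalerDr [x - p + _]addrC subrKA.
  rewrite dotpDr dotpZr.
  have : - B <= dotp (a j) (w - x).
    by rewrite dotpBr /B opprD lerD// lerN2; exact: Px.
  have te : 0 < t^-1 * e by rewrite mulr_gt0// invr_gt0.
  rewrite -(ler_pM2l te) mulrN; lra.
have : (volume D + volume E <= volume (cap a (a i) z))%E.
  rewrite -measureU//; apply: le_measure; rewrite ?inE//; first exact: measurableU.
  by move=> y [/Dcap'|/Ecap].
rewrite (lebesgue_rV_shrink _ t0 (measurable_polyhedron a)) (lebesgue_rV_shrink _ e0 mcap).
rewrite -(fineK (polyhedron_fin PN)) -(fineK (cap_fin PN _ _)) -!EFinM -EFinD lee_fin.
have : 0 < e ^+ n * fine (volume (cap a (a i) z)) by rewrite mulr_gt0// exprn_gt0.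
move: Vz; rewrite [v * _]mulrC; lra.
Qed.

End pyramid.

(** * Faces and normals *)

Section affine_geometry.
Context {R : realType} {n : nat}.
Implicit Types (b x : 'rV[R]_n) (S F : set 'rV[R]_n).

Definition dotp_kernel b : {vspace 'rV[R]_n} :=
  lker (linfun (mulmxr (b^T) : 'rV[R]_n -> 'M[R]_1)).

Lemma mem_dotp_kernel b x : (x \in dotp_kernel b) = (dotp b x == 0).
Proof.
rewrite memv_ker lfunE /= dotpC /dotp; apply/eqP/eqP => [->|xb]; first by rewrite mxE.
by apply/matrixP => i j; rewrite !ord1 xb mxE.
Qed.

Lemma affine_hull_sub S : S `<=` affine_hull S.
Proof. exact: sub_smallest. Qed.

Lemma affine_hull_hyperplane b (t : R) S : S !=set0 ->
  (forall x, S x -> dotp b x = t) -> forall x, affine_hull S x -> dotp b x = t.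
Proof.
move=> [x0 Sx0] St x Sx.
suff : affine_space x0 (dotp_kernel b) x.
  by rewrite /affine_space /= mem_dotp_kernel dotpBr (St _ Sx0) subr_eq0 => /eqP.
apply: Sx; split; first by right; exists x0, (dotp_kernel b).
by move=> y Sy; rewrite /affine_space /= mem_dotp_kernel dotpBr !St// subrr.
Qed.

Lemma affine_hull_id S : affine_subspace S -> affine_hull S = S.
Proof.
move=> aS; apply/seteqP; split; last exact: affine_hull_sub.
exact: smallest_sub.
Qed.

Lemma affine_dim_nonempty S (d : nat) : affine_dim S = d%:Z -> S !=set0.
Proof. by move=> Sd; apply/set0P/eqP => S0; move: Sd; rewrite S0 affine_dim0. Qed.

Lemma affine_hull_space S x0 (d : nat) : S x0 -> affine_dim S = d%:Z ->
  exists2 U : {vspace 'rV[R]_n}, \dim U = d & affine_hull S = affine_space x0 U.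
Proof.
move=> Sx0 Sd; have [|x1 [U SU]] := @affine_hullE R n S; first by exists x0.
exists U; first by move: Sd; rewrite (affine_dimE SU) => -[].
by rewrite SU; apply: affine_space_translate; rewrite -SU; exact: affine_hull_sub.
Qed.

(** The direction [U] of the hull has dimension [n.-1] and does not contain [x0], since [a] vanishes
    on [U] and is 1 at [x0]. So [U] and [x0] span the space, and [b] agrees with [t *: a] on
    both. *)
Lemma facet_normal F a b (t : R) : (0 < n)%N -> F !=set0 ->
  affine_dim F = n%:Z - 1 ->
  (forall x, F x -> dotp a x = 1) -> (forall x, F x -> dotp b x = t) -> b = t *: a.
Proof.
move=> n0 [x0 Fx0] Fdim Fa Fb.
have Fdim' : affine_dim F = (n.-1)%:Z by rewrite Fdim -predn_int.
have [U dU FU] := affine_hull_space Fx0 Fdim'.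
have F0 : F !=set0 by exists x0.
have constU c (s : R) : (forall x, F x -> dotp c x = s) -> forall u, u \in U -> dotp c u = 0.
  move=> Fc u uU.
  have : affine_hull F (u + x0) by rewrite FU /affine_space /= addrK.
  move/(affine_hull_hyperplane F0 Fc); rewrite dotpDr (Fc _ Fx0) => /eqP.
  by rewrite -subr_eq0 addrK => /eqP.
have x0U : x0 \notin U.
  by apply/negP => /(constU _ _ Fa)/eqP; rewrite (Fa _ Fx0) oner_eq0.
have Ux0 : (U + <[x0]>)%VS = fullv.
  apply/eqP; rewrite eqEdim subvf /= dimvf /dim/= mul1n.
  suff : (\dim U < \dim (U + <[x0]>))%N by rewrite dU prednK.
  rewrite ltn_neqAle dimvS ?addvSl// andbT; apply: contra x0U => /eqP dE.
  have /eqP -> : U == (U + <[x0]>)%VS by rewrite eqEdim addvSl dE /=.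
  by rewrite memvE addvSr.
apply/eqP; rewrite -subr_eq0; apply/eqP/dotp_inj => z; rewrite dotp0l.
have : z \in (U + <[x0]>)%VS by rewrite Ux0 memvf.
move=> /memv_addP[u uU [w /vlineP[k ->] ->]].
rewrite dotpDr dotpZr !dotpBl !dotpZl (constU _ _ Fb)// (constU _ _ Fa)//.
by rewrite (Fa _ Fx0) (Fb _ Fx0) mulr0 mulr1 !subrr mulr0 addr0.
Qed.

Lemma convex_sum k (C : set 'rV[R]_n) (v : 'I_k -> 'rV[R]_n) (l : 'I_k -> R) :
  @convex_set R 'rV[R]_n C -> (forall j, C (v j)) -> (forall j, 0 <= l j) ->
  \sum_j l j = 1 -> C (\sum_j l j *: v j).
Proof.
move=> /convex_setP cC; elim: k v l => [|k IHk] v l Cv l0 l1.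
  by move: l1; rewrite big_ord0 => /eqP; rewrite eq_sym oner_eq0.
move: l1; rewrite !big_ord_recl => l1.
set s := \sum_(i < k) l (lift ord0 i) in l1.
have s0 : 0 <= s by apply: sumr_ge0.
have sE : s = 1 - l ord0 by rewrite -l1 addrC addKr.
have [sz|sN0] := eqVneq s 0.
  have -> : l ord0 = 1 by rewrite -l1 sz addr0.
  rewrite scale1r big1 ?addr0// => i _.
  have /eqP := sz; rewrite psumr_eq0// => /allP/(_ i (mem_index_enum _)) /= /eqP ->.
  by rewrite scale0r.
have -> : \sum_(i < k) l (lift ord0 i) *: v (lift ord0 i) =
    (1 - l ord0) *: \sum_(i < k) (l (lift ord0 i) / s) *: v (lift ord0 i).
  rewrite -sE scaler_sumr; apply: eq_bigr => i _.
  by rewrite scalerA mulrC divfK.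
apply: cC => //.
  apply: IHk => // [j|]; first by rewrite divr_ge0.
  by rewrite -mulr_suml mulfV.
by rewrite l0/= -subr_ge0 -sE.
Qed.

End affine_geometry.

(** * Independence of normals and active constraints *)

Section normals.
Context {R : realType} {n m : nat}.
Variable a : 'I_m -> 'rV[R]_n.
Local Notation P := (polyhedron a).
Implicit Types (I : {set 'I_m}) (x d : 'rV[R]_n).

(** Spanning is stated through orthogonality, the form in which [polyhedron_ray] provides it and
    vertices use it. *)
Definition spanning I := forall d, (forall i, i \in I -> dotp (a i) d = 0) -> d = 0.

Definition independent I := forall l : 'I_m -> R,
  \sum_(i in I) l i *: a i = 0 -> forall i, i \in I -> l i = 0.

Definition normal_matrix I : 'M[R]_(#|I|, n) := \matrix_(k < #|I|) a (enum_val k).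

Lemma spanning_rank I : spanning I -> \rank (normal_matrix I) = n.
Proof.
move=> sI; rewrite -mxrank_tr; apply/eqP; rewrite -[_ == _]/(row_free _) -kermx_eq0.
apply/eqP/row_matrixP => r; rewrite row0; apply: sI => i iI.
have : row r (kermx (normal_matrix I)^T) *m (normal_matrix I)^T = 0.
  by rewrite -row_mul mulmx_ker row0.
move=> /rowP/(_ (enum_rank_in iI i)); rewrite !mxE => rI.
rewrite dotpC dotpE -[RHS]rI; apply: eq_bigr => j _; congr (_ * _).
by rewrite !mxE enum_rankK_in.
Qed.

Lemma spanning_independent I : spanning I -> #|I| = n -> independent I.
Proof.
move=> sI cI l l0 i iI.
have fI : row_free (normal_matrix I) by rewrite /row_free spanning_rank// cI.
have : \row_k l (enum_val k) *m normal_matrix I = 0.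
  rewrite mulmx_sum_row -[RHS]l0 [RHS]big_enum_val; apply: eq_bigr => k _.
  by rewrite mxE rowK.
move/eqP; rewrite mulmx_free_eq0// => /eqP/rowP/(_ (enum_rank_in iI i)).
by rewrite !mxE enum_rankK_in.
Qed.

Lemma independent_subset (I J : {set 'I_m}) : I \subset J -> independent J -> independent I.
Proof.
move=> IJ iJ l l0 i iI.
have := iJ (fun i => if i \in I then l i else 0).
rewrite (big_setID I)/= (finset.setIidPr IJ) [X in _ + X]big1 ?addr0; last first.
  by move=> k; rewrite inE => /andP[/negbTE -> _]; rewrite scale0r.
rewrite (eq_bigr (fun i => l i *: a i)); last by move=> k ->.
by move=> /(_ l0 i (fintype.subsetP IJ _ iI)); rewrite iI.
Qed.

Lemma affine_dim_normals I : independent I -> I != finset.set0 ->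
  affine_dim (affine_hull [set a i | i in [set` I]]) = #|I|%:Z - 1.
Proof.
move=> indI /finset.set0Pn[i0 i0I].
pose J := (I :\ i0)%SET.
pose X := [tuple a (enum_val k) - a i0 | k < #|J|].
pose S := [set a i | i in [set` I]].
have Sa i : i \in I -> S (a i) by move=> iI; exists i.
have XE k : X`_(k : 'I_#|J|) = a (enum_val k) - a i0 by rewrite -tnth_nth tnth_mktuple.
have hullE : affine_hull S = affine_space (a i0) <<X>>%VS.
  apply/seteqP; split.
    apply: smallest_sub; first by right; exists (a i0), <<X>>%VS.
    move=> _ [i /= iI <-]; rewrite /affine_space /=.
    have [->|ii0] := eqVneq i i0; first by rewrite subrr mem0v.
    have iJ : i \in J by rewrite !inE ii0.
    apply: memv_span; rewrite -[i](enum_rankK_in iJ iJ) -XE.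
    by rewrite mem_nth// size_tuple.
  move=> x Xx V [[->|[x1 [V' ->]]] SV]; first by have := SV _ (Sa _ i0I).
  have V0 := affine_space_translate (SV _ (Sa _ i0I)); rewrite V0 in SV *.
  suff /subvP XV : (<<X>> <= V')%VS by exact: XV.
  apply/span_subvP => _ /tnthP[k ->]; rewrite tnth_mktuple.
  have := SV _ (Sa (enum_val k) _); apply.
  by have := enum_valP k; rewrite !inE => /andP[].
rewrite -/S (affine_dimE (x0 := a i0) (U := <<X>>%VS)); last first.
  by rewrite hullE affine_hull_id//; right; exists (a i0), <<X>>%VS.
have fX : free X.
  apply/freeP => l l0 k.
  (* A relation among the differences becomes one among the normals, the coefficient of [a i0] being
     minus the sum of the others. *)
  pose g i := \sum_(k | enum_val k == i :> 'I_m) l k.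
  have gE (k' : 'I_#|J|) : g (enum_val k') = l k'.
    by rewrite /g (big_pred1 k')// => k''; rewrite (inj_eq enum_val_inj).
  pose s := \sum_k l k.
  pose h i := if i == i0 then - s else g i.
  have := indI h; rewrite (big_setD1 i0)//= => /(_ _ (enum_val k)).
  rewrite /h eqxx.
  have kJ : enum_val k \in J by exact: enum_valP.
  move: (kJ); rewrite !inE => /andP[/negbTE -> kI]; rewrite gE; apply => //.
  rewrite (eq_bigr (fun i => g i *: a i)); last first.
    by move=> i; rewrite !inE => /andP[/negbTE ->].
  rewrite big_enum_val /= (eq_bigr (fun k => l k *: a (enum_val k))); last first.
    by move=> k' _; rewrite gE.
  rewrite scaleNr scaler_suml addrC -sumrB -[RHS]l0.
  by apply: eq_bigr => k' _; rewrite XE scalerBr.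
have : (0 < #|I|)%N by apply/card_gt0P; exists i0.
move/eqP: fX => ->; rewrite size_tuple (cardsD1 i0 I) i0I /= => _.
by rewrite add1n -addn1 PoszD addrK.
Qed.

Definition active x : {set 'I_m} := [set i | dotp (a i) x == 1]%SET.

(** The sum of the active normals supports [P] at [x]: reaching its bound, the number of these
    normals, makes each of them tight, and spanning leaves only [x]. *)
Lemma vertex_of_spanning x : P x -> spanning (active x) -> vertex P x.
Proof.
move=> Px sx; exists (\sum_(i in active x) a i), (#|active x|%:R).
have cE y : dotp (\sum_(i in active x) a i) y = \sum_(i in active x) dotp (a i) y.
  exact: dotp_suml.
split=> [y Py|].
  by rewrite cE -sum1_card natr_sum; apply: ler_sum => i _; exact: Py.
apply/seteqP; split=> [_ ->|y [Py /= cy]].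
  split=> //=; rewrite cE -sum1_card natr_sum; apply: eq_bigr => i.
  by rewrite inE => /eqP.
apply/eqP; rewrite -subr_eq0; apply/eqP/sx => i ix.
have : \sum_(i in active x) (1 - dotp (a i) y) = 0.
  by rewrite sumrB -cE cy sumr_const subrr.
move/eqP; rewrite psumr_eq0; last by move=> j _; rewrite subr_ge0; exact: Py.
move/allP/(_ i (mem_index_enum _)); rewrite ix /= subr_eq0 => /eqP yi.
by move: ix; rewrite inE dotpBr -yi => /eqP ->; rewrite subrr.
Qed.

End normals.

Section faces.
Context {R : realType} {n m : nat}.
Variables (a : 'I_m -> 'rV[R]_n) (N : R).
Local Notation P := (polyhedron a).
Hypothesis PN : P `<=` cube n N.
Implicit Types (F : set 'rV[R]_n) (x d : 'rV[R]_n).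

Lemma active_step x d : P x -> d != 0 ->
  (forall i, i \in active a x -> dotp (a i) d = 0) ->
  exists t, [/\ 0 < t, P (x + t *: d) & active a x \proper active a (x + t *: d)].
Proof.
move=> Px d0 dx.
have [j0 dj0] : exists j, 0 < dotp (a j) d.
  apply: contrapT => /forallNP H; move/eqP: d0; apply.
  by apply: (polyhedron_ray PN) => j; rewrite leNgt; apply/negP/H.
(* [T j] is the time at which constraint [j] becomes tight; the first one stops the motion.
   Boundedness provided [j0]. *)
pose T j := (1 - dotp (a j) x) / dotp (a j) d.
pose j1 := [arg min_(j < j0 | 0 < dotp (a j) d) T j]%O.
have [dj1 T1] : 0 < dotp (a j1) d /\ forall j, 0 < dotp (a j) d -> T j1 <= T j.
  by rewrite /j1; case: Order.TotalTheory.arg_minP.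
have j1x : j1 \notin active a x.
  by apply/negP => /dx dj; move: dj1; rewrite dj ltxx.
have t0 : 0 < T j1.
  rewrite divr_gt0// subr_gt0 lt_neqAle Px andbT.
  by move: j1x; rewrite inE.
exists (T j1); split => //.
  move=> j; rewrite dotpDr dotpZr; have [dj|dj] := leP (dotp (a j) d) 0.
    by rewrite (le_trans _ (Px j))// gerDl mulr_ge0_le0// ltW.
  by rewrite -lerBrDl -ler_pdivlMr//; exact: T1.
apply/properP; split.
  apply/fintype.subsetP => j jx; move: (jx); rewrite !inE dotpDr dotpZr => /eqP ->.
  by rewrite (dx _ jx) mulr0 addr0.
exists j1 => //; rewrite inE dotpDr dotpZr /T divfK ?(gt_eqF dj1)// subrKC//.
Qed.

(** Take a point of [F] with most active constraints. If [d] were nonzero and orthogonal to their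
    normals, small steps along [d] and [- d] would stay in [P], so [b] would vanish on [d] and a
    step would reach a point of [F] with more active constraints. *)
Lemma face_vertex F : face P F -> F !=set0 ->
  exists2 x, F x & spanning a (active a x).
Proof.
move=> [b [t [Pb FE]]] [x0 Fx0].
pose Q k := `[< exists2 x, F x & #|active a x| = k >].
have exQ : exists k, Q k by exists #|active a x0|; apply/asboolP; exists x0.
have Qm k : Q k -> (k <= m)%N.
  by move=> /asboolP[x _ <-]; rewrite -[X in (_ <= X)%N]card_ord max_card.
case: (ex_maxnP exQ Qm) => k /asboolP[x Fx <-] kmax; exists x => //.
move=> d dx; apply/eqP/negPn/negP => d0.
have [Px bx] : P x /\ dotp b x = t by move: Fx; rewrite FE.
have [s [s0 Ps sx]] := active_step Px d0 dx.
have dN0 : - d != 0 by rewrite oppr_eq0.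
have [s' [s'0 Ps' _]] : exists s, [/\ 0 < s, P (x + s *: - d) &
    active a x \proper active a (x + s *: - d)].
  by apply: active_step => // i ix; rewrite dotpNr dx ?oppr0.
have bd : dotp b d = 0.
  apply/eqP; rewrite eq_le.
  have := Pb _ Ps; rewrite dotpDr dotpZr bx gerDl pmulr_rle0// => ->.
  by have := Pb _ Ps'; rewrite dotpDr dotpZr bx gerDl pmulr_rle0// dotpNr oppr_le0.
have : (#|active a (x + s *: d)| <= #|active a x|)%N.
  apply: kmax; apply/asboolP; exists (x + s *: d) => //.
  by rewrite FE; split => //=; rewrite dotpDr dotpZr bd mulr0 addr0.
by rewrite leqNgt proper_card.
Qed.

(* A point of the face with fewest active constraints is active only where the
   whole face is; if no constraint is active there, it is interior to [P]. *)
Lemma proper_face_sub_facet F : face P F -> F !=set0 -> F <> P ->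
  exists i, F `<=` face_of_normal P (a i).
Proof.
move=> [b [t [Pb FE]]] [x0 Fx0] FP.
pose Q k := `[< exists2 x, F x & #|active a x| = k >].
have exQ : exists k, Q k by exists #|active a x0|; apply/asboolP; exists x0.
case: (ex_minnP exQ) => k /asboolP[x Fx <-] kmin.
have [Px bx] : P x /\ dotp b x = t by move: Fx; rewrite FE.
have [b0|bN0] := eqVneq b 0.
  case: FP; rewrite FE; apply/seteqP; split=> [y []//|y Py]; split => //=.
  by rewrite -bx b0 !dotp0l.
(* With no active constraint, a step along [b] itself would push [dotp b] above its maximum [t]. *)
have [i ix] : exists i, i \in active a x.
  apply: contrapT => /forallNP H.
  have [i /H//|s [s0 Ps _]] := active_step Px bN0.
  have := Pb _ Ps; rewrite dotpDr dotpZr bx gerDl pmulr_rle0//.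
  rewrite leNgt lt_neqAle eq_sym (_ : 0 <= dotp b b) ?andbT; last first.
    by rewrite dotpE sumr_ge0// => j _; rewrite -expr2 sqr_ge0.
  by move/negPn/eqP/dotp_self_eq0/eqP; apply/negP.
exists i => y Fy.
have [Py by_] : P y /\ dotp b y = t by move: Fy; rewrite FE.
split => //=; apply/eqP; rewrite eq_le Py/= leNgt; apply/negP => yi.
(* A constraint active at the midpoint is active at both ends; [i] is not active at [y], so [w] has
   fewer active constraints than [x]. *)
pose w := 2^-1 *: x + (1 - 2^-1) *: y.
have h : 1 - 2^-1 = 2^-1 :> R by field.
have Fw : F w.
  rewrite FE; split; last by rewrite /= /w dotpDr !dotpZr bx by_ -mulrDl subrKC mul1r.
  by apply: polyhedron_convex => //; rewrite invr_ge0 ler0n/= invf_le1// ler1n.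
have : (#|active a x| <= #|active a w|)%N.
  by apply: kmin; apply/asboolP; exists w.
rewrite leqNgt proper_card//; apply/properP; split; last first.
  exists i => //; rewrite inE /w h dotpDr !dotpZr lt_eqF//.
  move: ix; rewrite inE => /eqP ->; lra.
apply/fintype.subsetP => j; rewrite !inE /w h dotpDr !dotpZr => /eqP jw.
by rewrite eq_le Px/=; have := Py j; lra.
Qed.

Hypothesis n_gt1 : (1 < n)%N.
Hypothesis a_inj : injective a.
Hypothesis facets : [set G | facet P G] = range (fun i => face_of_normal P (a i)).

Lemma facet_face_of_normal i : facet P (face_of_normal P (a i)).
Proof.
suff : [set G | facet P G] (face_of_normal P (a i)) by [].
by rewrite facets; exists i.
Qed.

Let n_gt0 : (0 < n)%N. Proof. exact: ltnW. Qed.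

Lemma normal_multiple i b (t : R) :
  (forall x, face_of_normal P (a i) x -> dotp b x = t) -> b = t *: a i.
Proof.
have [_ Fdim] := facet_face_of_normal i.
apply: (facet_normal n_gt0 _ Fdim); last by move=> x [].
by apply: (@affine_dim_nonempty _ _ _ n.-1); rewrite Fdim -predn_int.
Qed.

Lemma facet_sub_eq i j :
  face_of_normal P (a j) `<=` face_of_normal P (a i) -> i = j.
Proof.
move=> Fji; apply: a_inj; rewrite -[RHS]scale1r; apply: normal_multiple.
by move=> x /Fji[].
Qed.

(** Simplicity counts facets; as distinct indices have distinct facets, it also counts active
    constraints. *)
Lemma card_active x : simple_polytope P -> vertex P x -> #|active a x| = n.
Proof.
move=> sP vx; have := sP _ vx.
have Px : P x.
  have [b [t [_ E]]] := vx; have : [set x] x by [].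
  by rewrite E => -[].
have -> : [set G | facet P G /\ G x] =
    (fun i => face_of_normal P (a i)) @` [set i | i \in active a x].
  apply/seteqP; split=> [G [PG Gx]|_ [i /= ix <-]].
    have : [set G | facet P G] G by [].
    rewrite facets => -[i _ GE]; exists i => //=.
    by move: Gx; rewrite -GE => -[_ /= ix]; rewrite inE; exact/eqP.
  split; first exact: facet_face_of_normal.
  by split => //=; move: ix; rewrite inE => /eqP.
have Finj : {in [set i | i \in active a x] &, injective (fun i => face_of_normal P (a i))}.
  by move=> i j _ _ E; apply: facet_sub_eq; rewrite E.
have -> : [set i | i \in active a x] = @enum_val _ (mem (active a x)) @` [set: 'I_#|active a x|].
  apply/seteqP; split=> [i /= ix|_ [k _ <-]]; last exact: enum_valP.
  by exists (enum_rank_in ix i) => //; rewrite enum_rankK_in.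
move=> H; apply/card_eq_II; rewrite -(card_eqr H).
apply: card_esym; rewrite image_comp.
apply: (card_eq_trans (inj_card_eq _)); last first.
  by apply: card_esym; exact: card_II.
move=> k l _ _ /= E; apply: enum_val_inj; apply: facet_sub_eq.
by rewrite E.
Qed.

Definition containing_facets F : {set 'I_m} :=
  finset (fun i => `[< F `<=` face_of_normal P (a i) >]).

Lemma in_containing_facets F i :
  i \in containing_facets F <-> F `<=` face_of_normal P (a i).
Proof. by split=> [|Fi]; rewrite inE; [move/asboolP|apply/asboolP]. Qed.

(** [F] contains a vertex, where the active normals span the space and are [n] in number, hence form
    a basis; the facets containing [F] are among the active ones. *)
Lemma normals_independent F : simple_polytope P -> face P F -> F !=set0 ->
  independent a (containing_facets F).
Proof.
move=> sP fF F0; have [x Fx sx] := face_vertex fF F0.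
have Px : P x by move: fF Fx => [b [t [_ ->]]] [].
apply: (@independent_subset _ _ _ _ _ (active a x)).
  apply/fintype.subsetP => i; move=> /in_containing_facets Fi; rewrite inE.
  by have [_ /= ->] := Fi _ Fx.
apply: spanning_independent => //; apply: card_active => //.
exact: vertex_of_spanning.
Qed.

(** A vector orthogonal to all normals but [a i] has, up to sign, a nonpositive product with [a i]
    as well, so it generates a ray in [P]. *)
Lemma spanning_setC1 i : spanning a [set~ i]%SET.
Proof.
move=> d di.
wlog : d di / dotp (a i) d <= 0.
  move=> H; have [|/ltW di0] := leP (dotp (a i) d) 0; first exact: H.
  apply/eqP; rewrite -oppr_eq0; apply/eqP/H.
    by move=> j ji; rewrite dotpNr di// oppr0.
  by rewrite dotpNr oppr_le0.
move=> di0; apply: (polyhedron_ray PN) => j.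
by have [->//|ji] := eqVneq j i; rewrite di ?lexx// !inE.
Qed.

(** If [dotp (a j) p < 1], projecting a point of the facet of [a j] from [p] onto the base increases
    [dotp (a j)] beyond 1 unless the point is already in the base. So that facet lies in the base,
    and [j = i]. *)
Lemma apex_active i p :
  P p -> dotp (a i) p = - n%:R ->
  (forall x, P x -> - n%:R <= dotp (a i) x) ->
  (forall x, P x -> - n%:R < dotp (a i) x ->
    P (p + (1 - (1 - dotp (a i) x) / (n%:R + 1))^-1 *: (x - p))) ->
  forall j, j != i -> dotp (a j) p = 1.
Proof.
move=> Pp pi Pi pyr j ji; apply/eqP; rewrite eq_le Pp/= leNgt; apply/negP => jp.
move/negP: ji; apply; apply/eqP/esym/facet_sub_eq => x [Px /= jx]; split => //=.
have nR : 0 < n%:R :> R by rewrite ltr0n.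
have H0 : 0 < n%:R + 1 :> R by rewrite ltr_wpDl.
have tp y (t : R) : 0 < t -> dotp (a j) (p + t^-1 *: (y - p)) <= 1 ->
    dotp (a j) y - dotp (a j) p <= t * (1 - dotp (a j) p).
  by move=> t0; rewrite dotpDr dotpZr dotpBr -lerBrDl ler_pdivrMl.
have tE y : - n%:R < dotp (a i) y -> 0 < 1 - (1 - dotp (a i) y) / (n%:R + 1).
  by move=> iy; rewrite subr_gt0 ltr_pdivrMr// mul1r; lra.
have [ix|ix] := ltP (- n%:R) (dotp (a i) x).
  have := tp _ _ (tE _ ix) (pyr _ Px ix j); rewrite jx.
  set t := 1 - _ => h.
  have : 1 <= t by rewrite -(ler_pM2r (_ : 0 < 1 - dotp (a j) p)) ?mul1r// subr_gt0.
  rewrite /t lerBrDl gerDr pmulr_lle0 ?invr_gt0// subr_le0 => h1.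
  by apply/eqP; rewrite eq_le h1 Px.
have {ix} ix : dotp (a i) x = - n%:R by apply/eqP; rewrite eq_le ix Pi.
exfalso.
pose g := 1 - dotp (a j) p; have g0 : 0 < g by rewrite subr_gt0.
(* A point at the level of the apex cannot be projected, so it is first moved towards 0. The
   dilation ratio at [y] is less than [e], hence [g - e < e * g], whereas [e * (1 + g) = g / 2]. *)
pose e := g / (2 * (1 + g)).
have g1 : 0 < 1 + g by rewrite addr_gt0.
have eE : e * (2 * (1 + g)) = g by rewrite divfK// gt_eqF// mulr_gt0.
have e0 : 0 < e by rewrite divr_gt0// mulr_gt0.
have e1 : e < 1 by rewrite ltr_pdivrMr ?mulr_gt0// mul1r; lra.
pose y := (1 - e) *: x.
have Py : P y.
  rewrite /y -[X in P X]addr0 -(scaler0 _ (1 - (1 - e))).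
  apply: polyhedron_convex => //; first exact: polyhedron0.
  by rewrite subr_ge0 (ltW e1)/= gerBl ltW.
have iyE : dotp (a i) y = - n%:R + e * n%:R by rewrite dotpZr ix; ring.
have iy : - n%:R < dotp (a i) y by rewrite iyE ltrDl mulr_gt0.
have := tp _ _ (tE _ iy) (pyr _ Py iy j).
rewrite dotpZr jx mulr1 iyE.
have -> : 1 - (1 - (- n%:R + e * n%:R)) / (n%:R + 1) = e * n%:R / (n%:R + 1) :> R.
  by field; rewrite gt_eqF.
rewrite mulrAC ler_pdivlMr// -/g => h.
have h2 : (g - e) * (n%:R + 1) <= e * g * n%:R.
  by move: h; rewrite /g; lra.
have eg : e * g = g / 2 - e.
  have : 2 * e + 2 * (e * g) = g by rewrite -[RHS]eE; ring.
  lra.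
have eg0 : 0 < e * g by rewrite mulr_gt0.
move: h2; rewrite eg; nra.
Qed.

End faces.

(** * Simplices and barycentric coordinates *)

Section simplices.
Context {R : realType}.

Definition homogeneous n (v : 'I_n.+1 -> 'rV[R]_n) : 'M[R]_n.+1 :=
  \matrix_(j, k) (if unlift ord0 k is Some k' then v j 0 k' else 1).

Lemma homogeneous_unit n (v : 'I_n.+1 -> 'rV[R]_n) :
  affinely_independent v -> homogeneous v \in unitmx.
Proof.
move=> iv; rewrite -row_free_unit -kermx_eq0; apply/eqP/row_matrixP => r.
rewrite row0; apply/rowP => j; rewrite [RHS]mxE.
set l := row r _.
have /rowP l0 : l *m homogeneous v = 0 by rewrite /l -row_mul mulmx_ker row0.
apply: iv.
  have := l0 ord0; rewrite [RHS]mxE mxE => E; rewrite -[RHS]E; apply: eq_bigr => k _.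
  by rewrite [X in _ * X]mxE unlift_none mulr1.
apply/rowP => i; have := l0 (lift ord0 i); rewrite [RHS]mxE mxE => E.
rewrite [RHS]mxE -[RHS]E summxE; apply: eq_bigr => k _.
by rewrite [LHS]mxE [homogeneous _ _ _]mxE liftK.
Qed.

Section barycentric.
Variables (n : nat) (v : 'I_n.+1 -> 'rV[R]_n).
Hypothesis iv : affinely_independent v.

(** Barycentric coordinates are the entries of the row (1, x) times the inverse matrix; the linear
    part is isolated so that it can be compared with facet normals. *)
Definition bary_coef (j : 'I_n.+1) : 'rV[R]_n :=
  \row_k invmx (homogeneous v) (lift ord0 k) j.

Definition bary (j : 'I_n.+1) (x : 'rV[R]_n) : R :=
  invmx (homogeneous v) ord0 j + dotp (bary_coef j) x.

Let lift_row (x : 'rV[R]_n) : 'rV[R]_n.+1 :=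
  \row_k (if unlift ord0 k is Some k' then x 0 k' else 1).

Let baryE j x : bary j x = (lift_row x *m invmx (homogeneous v)) 0 j.
Proof.
rewrite /bary mxE big_ord_recl !mxE unlift_none mul1r; congr (_ + _).
by rewrite dotpE; apply: eq_bigr => k _; rewrite !mxE liftK mulrC.
Qed.

Let bary_row x : \row_j bary j x *m homogeneous v = lift_row x.
Proof.
have -> : \row_j bary j x = lift_row x *m invmx (homogeneous v).
  by apply/rowP => j; rewrite mxE baryE.
by rewrite mulmxKV// homogeneous_unit.
Qed.

Lemma bary_sum x : \sum_j bary j x = 1.
Proof.
have /rowP/(_ ord0) := bary_row x; rewrite !mxE unlift_none => <-.
by apply: eq_bigr => j _; rewrite !mxE unlift_none mulr1.
Qed.

Lemma bary_combination x : \sum_j bary j x *: v j = x.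
Proof.
apply/rowP => k; have /rowP/(_ (lift ord0 k)) := bary_row x.
rewrite !mxE liftK => <-; rewrite summxE.
by apply: eq_bigr => j _; rewrite !mxE liftK.
Qed.

Lemma bary_vertex j k : bary j (v k) = (j == k)%:R.
Proof.
have := iv (l := fun i => bary i (v k) - (i == k)%:R).
have d1 : \sum_i (i == k)%:R = 1 :> R.
  by rewrite (bigD1 k)//= eqxx big1 ?addr0// => i /negbTE ->.
have d2 : \sum_i (i == k)%:R *: v i = v k.
  by rewrite (bigD1 k)//= eqxx scale1r big1 ?addr0// => i /negbTE ->; rewrite scale0r.
rewrite sumrB bary_sum d1 subrr => /(_ erefl).
under eq_bigr do rewrite scalerBl.
rewrite sumrB bary_combination d2 subrr => /(_ erefl j)/eqP.
by rewrite subr_eq0 => /eqP.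
Qed.

Lemma affine_vertices b (t : R) x :
  t - dotp b x = \sum_j bary j x * (t - dotp b (v j)).
Proof.
rewrite -{1}(bary_combination x) dotp_sumr -[t in LHS]mul1r -(bary_sum x) mulr_suml -sumrB.
by apply: eq_bigr => j _; rewrite dotpZr mulrBr.
Qed.

End barycentric.

Section simplex_of_card.
Variables (n : nat) (a : 'I_n.+1 -> 'rV[R]_n) (N : R).
Local Notation P := (polyhedron a).
Hypothesis PN : P `<=` cube n N.

(** The [n] normals other than [a j] span the space, so the square system they define is
    solvable. *)
Lemma opposite_vertex j : exists v, forall l, l != j -> dotp (a l) v = 1.
Proof.
pose M : 'M[R]_n := \matrix_k a (lift j k).
have uM : M^T \in unitmx.
  rewrite -row_free_unit -kermx_eq0; apply/eqP/row_matrixP => r; rewrite row0.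
  apply: (spanning_setC1 PN (i := j)) => l; rewrite !inE.
  have [k ->|->] := unliftP j l; last by rewrite eqxx.
  move=> _; have : row r (kermx M^T) *m M^T = 0 by rewrite -row_mul mulmx_ker row0.
  move=> /rowP/(_ k); rewrite !mxE => rk.
  by rewrite dotpC dotpE -[RHS]rk; apply: eq_bigr => i _; rewrite !mxE.
exists (const_mx 1 *m invmx M^T) => l lj.
have [k lk|lE] := unliftP j l; last by rewrite lE eqxx in lj.
have /rowP/(_ k) : const_mx 1 *m invmx M^T *m M^T = const_mx 1 :> 'rV[R]_n by rewrite mulmxKV.
rewrite mxE [RHS]mxE => E; rewrite -[RHS]E lk dotpC dotpE; apply: eq_bigr => i _.
by rewrite [M^T i k]mxE [M k i]mxE.
Qed.

(** If [dotp (a j) (v j) >= 1], then [- v j] would generate a ray; so it is less than 1. The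
    barycentric coordinate of [x] at [v j] is the slack of [a j] at [x] divided by its slack at
    [v j], hence nonnegative on [P]. *)
Lemma bounded_polyhedron_simplex : simplex P.
Proof.
have [v vE] : exists v : 'I_n.+1 -> 'rV[R]_n, forall j l, l != j -> dotp (a l) (v j) = 1.
  exists (fun j => projT1 (cid (opposite_vertex j))) => j.
  by case: cid.
have vj j : dotp (a j) (v j) < 1.
  rewrite ltNge; apply/negP => vj1.
  have v0 : - v j = 0.
    apply: (polyhedron_ray PN) => l; rewrite dotpNr oppr_le0.
    by have [->|lj] := eqVneq l j; [exact: le_trans vj1|rewrite vE].
  by move: vj1; rewrite -[v j]opprK v0 oppr0 dotp0r ler10.
have Pv j : P (v j).
  by move=> l; have [->|lj] := eqVneq l j; [exact: ltW|rewrite vE].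
have iv : affinely_independent v.
  move=> l l1 l0 k.
  have : \sum_j l j * (1 - dotp (a k) (v j)) = 0.
    under eq_bigr do rewrite mulrBr mulr1 -dotpZr.
    by rewrite sumrB l1 -dotp_sumr l0 dotp0r subrr.
  rewrite (bigD1 k)//= big1 ?addr0; last first.
    by move=> j jk; rewrite vE 1?eq_sym// subrr mulr0.
  by move/eqP; rewrite mulf_eq0 subr_eq0 (gt_eqF (vj k)) orbF => /eqP.
exists v; split => //; apply/seteqP; split; last first.
  apply: smallest_sub; last by move=> _ [j _ <-]; exact: Pv.
  by apply/convex_setP => x y t Px Py t01; exact: polyhedron_convex.
move=> x Px; rewrite -(bary_combination iv x).
apply: convex_sum; last exact: bary_sum.
- exact: convex_hull_convex.
- by move=> j; apply: convex_hull_sub; exists j.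
move=> j; have := affine_vertices iv (a j) 1 x.
rewrite (bigD1 j)//= big1 ?addr0; last first.
  by move=> k kj; rewrite vE 1?eq_sym// subrr mulr0.
by move=> E; rewrite -(pmulr_lge0 _ (_ : 0 < 1 - dotp (a j) (v j))) ?subr_gt0// -E subr_ge0.
Qed.

End simplex_of_card.

Lemma simplex_of_card n m (a : 'I_m -> 'rV[R]_n) (N : R) : m = n.+1 ->
  polyhedron a `<=` cube n N -> simplex (polyhedron a).
Proof. by move=> mE; subst m; exact: bounded_polyhedron_simplex. Qed.

(* The barycentric coordinate that misses a facet is an affine functional
   constant on it, so it determines the normal of the facet. *)
Lemma simplex_facet_card n m (a : 'I_m -> 'rV[R]_n) (N : R) :
  polyhedron a `<=` cube n N -> (1 < n)%N -> injective a ->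
  [set G | facet (polyhedron a) G] =
    range (fun i => face_of_normal (polyhedron a) (a i)) ->
  simplex (polyhedron a) -> (m <= n.+1)%N.
Proof.
move=> PN n1 ainj facets [v [iv PE]].
set P := polyhedron a in PN facets PE.
(* Otherwise [dotp (a i)] would be at least 1 on all of [P], which contains 0. *)
have miss i : exists j, dotp (a i) (v j) < 1.
  apply: contrapT => /forallNP H.
  have : P `<=` [set x | dotp (- a i) x <= -1].
    rewrite PE; apply: smallest_sub; first exact: convex_halfspace.
    move=> _ [j _ <-] /=; rewrite dotpNl lerN2 leNgt; exact/negP/H.
  by move=> /(_ 0 (polyhedron0 a)) /=; rewrite dotp0r lerNr oppr0 ler10.
pose f i := projT1 (cid (miss i)).
have fP i : dotp (a i) (v (f i)) < 1 by rewrite /f; case: cid.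
have Pv j : P (v j) by rewrite PE; apply: convex_hull_sub; exists j.
have bary_ge0 x j : P x -> 0 <= bary v j x.
  rewrite PE => Px.
  have : [set y | dotp (- bary_coef v j) y <= invmx (homogeneous v) ord0 j] x.
    apply: Px; split; first exact: convex_halfspace.
    move=> _ [k _ <-] /=; rewrite dotpNl -subr_ge0 opprK -/(bary v j (v k)).
    by rewrite bary_vertex// ler0n.
  by rewrite /= dotpNl -subr_ge0 opprK.
have bary0 i x : face_of_normal P (a i) x -> bary v (f i) x = 0.
  move=> [Px /= ix].
  have := affine_vertices iv (a i) 1 x; rewrite ix subrr => /esym/eqP.
  rewrite psumr_eq0; last first.
    by move=> j _; rewrite mulr_ge0 ?bary_ge0// subr_ge0; exact: Pv.
  move/allP/(_ (f i) (mem_index_enum _)); rewrite /= mulf_eq0 subr_eq0.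
  by rewrite (gt_eqF (fP i)) orbF => /eqP.
have coefE i : bary_coef v (f i) = - invmx (homogeneous v) ord0 (f i) *: a i.
  apply: (normal_multiple n1 facets) => x /bary0/eqP.
  by rewrite /bary addrC addr_eq0 => /eqP.
have coefN0 j : bary_coef v j != 0.
  apply/eqP => b0.
  have [k kj] : exists k : 'I_n.+1, k != j.
    have [->|j0] := eqVneq j ord0; last by exists ord0; rewrite eq_sym.
    by exists ord_max; rewrite -val_eqE /= -lt0n (ltn_trans _ n1).
  have := bary_vertex iv j k; have := bary_vertex iv j j.
  rewrite /bary b0 !dotp0l eqxx => ->.
  by rewrite eq_sym (negbTE kj) => /eqP; rewrite oner_eq0.
(* Equal indices give one nonzero vector as the same scalar multiple of [a i] and [a i']; the scalar
   is then nonzero and cancels. *)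
have finj : injective f.
  move=> i i' fii'; apply: ainj.
  have := coefE i; rewrite fii' coefE => /eqP; rewrite -subr_eq0 -scalerBr scaler_eq0.
  case/orP => [/eqP h|]; last by rewrite subr_eq0 => /eqP.
  by move: (coefN0 (f i')); rewrite coefE h scale0r eqxx.
by have := leq_card f finj; rewrite !card_ord.
Qed.

End simplices.

(** * The equality case *)

Section polytopes.
Context {R : realType} {n : nat}.
Implicit Types (P : set 'rV[R]_n) (b x : 'rV[R]_n).

Lemma convex_cube N : @convex_set R 'rV[R]_n (cube n N).
Proof.
apply/convex_setP => x y t xN yN /andP[t0 t1] j; rewrite !mxE.
have -> : N = t * N + (1 - t) * N by rewrite -mulrDl subrKC mul1r.
apply: (le_trans (ler_normD _ _)); rewrite !normrM (ger0_norm t0).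
rewrite [`|1 - t|]ger0_norm ?subr_ge0//.
by rewrite lerD// ler_wpM2l// subr_ge0.
Qed.

Lemma polytope_bounded P : polytope P -> exists N, P `<=` cube n N.
Proof.
move=> [s ->]; exists (\sum_(x <- s) \sum_j `|x 0 j|).
apply: smallest_sub; first exact: convex_cube.
move=> x /= xs i; rewrite (big_rem x)//= (bigD1 i)//=.
by rewrite -addrA lerDl addr_ge0// ?sumr_ge0// => y _; rewrite sumr_ge0.
Qed.

Lemma polytope_min P b : polytope P -> P !=set0 ->
  exists2 p, P p & forall x, P x -> dotp b p <= dotp b x.
Proof.
move=> [s PE] [x0 Px0].
have [s0|[p0 p0s]] : s = [::] \/ exists p, p \in s.
  by case: s {PE} => [|p s]; [left|right; exists p; rewrite mem_head].
  exfalso; move: Px0; rewrite PE s0.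
  have : convex_hull [set` [::]] `<=` (@set0 'rV[R]_n).
    by apply: smallest_sub => //; apply/convex_setP.
  by move=> /[apply].
have [p ps pmin] : exists2 p, p \in s & forall x, x \in s -> dotp b p <= dotp b x.
  have i0 : 'I_(size s) by exists (index p0 s); rewrite index_mem.
  pose i := [arg min_(i < i0) dotp b (nth 0 s i)]%O.
  have imin j : dotp b (nth 0 s i) <= dotp b (nth 0 s (j : 'I_(size s))).
    by rewrite /i; case: Order.TotalTheory.arg_minP => // k _; exact.
  exists (nth 0 s i); first exact: mem_nth.
  move=> x xs; have xi : (index x s < size s)%N by rewrite index_mem.
  by have := imin (Ordinal xi); rewrite /= nth_index.
exists p; first by rewrite PE; apply: convex_hull_sub.
rewrite PE => x Px.
have : [set y | dotp (- b) y <= - dotp b p] x.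
  apply: Px; split; first exact: convex_halfspace.
  by move=> y ys /=; rewrite dotpNl lerN2; exact: pmin.
by rewrite /= dotpNl lerN2.
Qed.

End polytopes.

Section equality_case.
Context {R : realType} {n m : nat}.
Variables (a : 'I_m -> 'rV[R]_n).
Local Notation volume := (lebesgue_rV R n).
Local Notation P := (polyhedron a).
Local Notation v := (fine (volume P)).
Local Notation c i := (fine (volume (facet_cone P (a i)))).
Hypothesis n_gt1 : (1 < n)%N.
Hypothesis P_polytope : polytope P.
Hypothesis P_centered : centered P.
Hypothesis a_inj : injective a.
Hypothesis facets : [set G | facet P G] = range (fun i => face_of_normal P (a i)).

Let n_gt0 : (0 < n)%N. Proof. exact: ltnW. Qed.

Let H_gt0 : 0 < n%:R + 1 :> R. Proof. by rewrite ltr_wpDl. Qed.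

Lemma facet_cone_le i : c i * (n%:R + 1) <= v.
Proof.
have [N PN] := polytope_bounded P_polytope.
have [|p Pp pmin] := polytope_min (a i) P_polytope; first by exists 0; exact: polyhedron0.
have pM : dotp (a i) p = 1 - (1 - dotp (a i) p) by ring.
have [] // := facet_inequality PN n_gt0 Pp pM; last exact: centered_slack PN _ P_centered.
by move=> x Px; rewrite subKr; exact: pmin.
Qed.

Lemma simplex_of_facet_cone i : simple_polytope P -> c i * (n%:R + 1) = v -> simplex P.
Proof.
move=> sP civ.
have [N PN] := polytope_bounded P_polytope.
have [|p Pp pmin] := polytope_min (a i) P_polytope; first by exists 0; exact: polyhedron0.
have pM : dotp (a i) p = 1 - (1 - dotp (a i) p) by ring.
have [||_] := facet_inequality PN n_gt0 Pp pM.
- by move=> x Px; rewrite subKr; exact: pmin.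
- exact: centered_slack PN _ P_centered.
move=> /(_ civ) pE; have {pM} pn : dotp (a i) p = - n%:R by lra.
have apex := apex_active n_gt1 a_inj facets Pp pn _
  (fun x => pyramid_of_equality PN n_gt0 Pp pn civ).
have {}apex j : j != i -> dotp (a j) p = 1.
  by move=> ji; apply: apex => // x Px; rewrite -pn; exact: pmin.
have actE : active a p = [set~ i]%SET.
  apply/finset.setP => j; rewrite !inE; have [->|ji] := eqVneq j i.
    by rewrite pn; apply/negbTE; rewrite lt_eqF// (@le_lt_trans _ _ 0)// oppr_le0.
  by rewrite (apex _ ji) eqxx.
have vp : vertex P p.
  by apply: vertex_of_spanning => //; rewrite actE; exact: (spanning_setC1 PN).
have := card_active n_gt1 a_inj facets sP vp; rewrite actE cardsC1 card_ord => mn.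
apply: (simplex_of_card _ PN).
by rewrite -mn prednK// (leq_ltn_trans _ (ltn_ord i)).
Qed.

Lemma simplex_facet_cone i : simplex P -> c i * (n%:R + 1) = v.
Proof.
move=> sP; have [N PN] := polytope_bounded P_polytope.
have mn := simplex_facet_card PN n_gt1 a_inj facets sP.
have cover : v <= \sum_j c j.
  rewrite -lee_fin fineK ?(polyhedron_fin PN)//.
  rewrite -sumEFin (eq_bigr (fun j => volume (facet_cone P (a j)))); last first.
    by move=> j _; rewrite fineK// (facet_cone_fin PN).
  exact: (polyhedron_cover PN i).
apply/eqP; rewrite eq_le facet_cone_le/= leNgt; apply/negP => civ.
(* One strict term makes the sum strict, and [m <= n.+1] then contradicts [cover]. *)
have : (\sum_j c j) * (n%:R + 1) < m%:R * v.
  have -> : m%:R * v = \sum_(j < m) v by rewrite sumr_const card_ord mulr_natl.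
  rewrite mulr_suml (bigD1 i)//= [ltRHS](bigD1 i)//= ltr_leD//.
  by apply: ler_sum => j _; exact: facet_cone_le.
have v0 : 0 <= v by exact: fine_ge0.
have mR : m%:R * v <= (n%:R + 1) * v.
  by rewrite ler_wpM2r// natr1 ler_nat.
have := ler_wpM2r (ltW H_gt0) cover.
by rewrite [v * _]mulrC => h1 h2; move: (le_lt_trans h1 h2); rewrite ltNge mR.
Qed.

End equality_case.

Theorem corollary1p3 (R : realType) (n m k : nat) (a : 'I_m -> 'rV[R]_n)
    (P F A : set 'rV[R]_n)
    (P_polytope : polytope P) (P_dim : affine_dim P = n%:Z)
    (P_centered : centered P) (P_simple : simple_polytope P)
    (P_desc : irredundant_description a P)
    (k_ge1 : (1 <= k)%N) (k_le : (k <= n - 1)%N)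
    (F_face : face P F) (F_dim : affine_dim F = k%:Z)
    (A_def : A = affine_hull
       [set a i | i in [set i | F `<=` face_of_normal P (a i)]]) :
  (\sum_(i < m | a i \in A) vol (facet_cone P (a i)) =
   (((affine_dim A)%:~R + 1) / (n%:R + 1) : R)%:E * vol P)%E
  <-> simplex P /\ centered P.
Proof.
have [PE _ a_inj facets] := P_desc.
have n_gt1 : (1 < n)%N by rewrite -subn_gt0 (leq_trans k_ge1).
have {PE} PE : P = polyhedron a by [].
subst P.
have [N PN] := polytope_bounded P_polytope.
have F_neq0 : F !=set0 by exact: affine_dim_nonempty F_dim.
have F_neqP : F <> polyhedron a.
  move=> FP; move: F_dim; rewrite FP P_dim => -[nk].
  by move: k_le; rewrite -nk subn1 leqNgt prednK ?leqnn// ltnW.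
pose I := containing_facets a F.
(* This makes the dimension formula for [A] valid and supplies a facet for the equality case; it
   rests on [F] being proper, from [k <= n - 1]. *)
have I_neq0 : I != finset.set0.
  have [i Fi] := proper_face_sub_facet PN F_face F_neq0 F_neqP.
  by apply/finset.set0Pn; exists i; apply/in_containing_facets.
have AE : A = affine_hull [set a i | i in [set` I]].
  rewrite A_def; congr affine_hull; congr (_ @` _).
  by apply/seteqP; split => i /= /in_containing_facets.
have I_indep := normals_independent PN n_gt1 a_inj facets P_simple F_face F_neq0.
have dimA : affine_dim A = #|I|%:Z - 1 by rewrite AE; exact: affine_dim_normals.
(* Each point [x] of [F] pairs to 1 with the normals in [I], hence with every point of their affine
   hull; a normal in [A] is therefore tight at all points of [F]. *)
have memA i : (a i \in A) = (i \in I).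
  apply/idP/idP => [|iI]; last first.
    by rewrite inE AE; apply: affine_hull_sub; exists i.
  rewrite inE AE => aiA; apply/in_containing_facets => x Fx; split.
    by move: F_face Fx => [b [t [_ ->]]] [].
  rewrite /= dotpC; apply: (affine_hull_hyperplane _ _ aiA).
    by have /finset.set0Pn[j jI] := I_neq0; exists (a j), j.
  by move=> _ [j /in_containing_facets Fj <-]; rewrite dotpC; case: (Fj _ Fx).
have n1 : n%:R + 1 != 0 :> R by rewrite gt_eqF// ltr_wpDl.
have lhsE : (\sum_(i < m | a i \in A) vol (facet_cone (polyhedron a) (a i)) =
    (\sum_(i in I) fine (vol (facet_cone (polyhedron a) (a i))))%:E)%E.
  rewrite -sumEFin; apply: eq_big => // i _.
  by rewrite fineK// (facet_cone_fin PN).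
rewrite lhsE dimA intrD addrNK -(fineK (polyhedron_fin PN)) -EFinM.
have le_cone := facet_cone_le n_gt1 P_polytope P_centered.
split=> [[sumE]|[sP _]].
  split => //; have /finset.set0Pn[i iI] := I_neq0.
  apply: (simplex_of_facet_cone n_gt1 P_polytope P_centered a_inj facets (i := i) P_simple).
  apply/eqP; rewrite eq_le le_cone/= leNgt; apply/negP => civ.
  have : (\sum_(i in I) fine (vol (facet_cone (polyhedron a) (a i)))) * (n%:R + 1) <
      #|I|%:R * fine (vol (polyhedron a)).
    rewrite mulr_natl -sumr_const mulr_suml (bigD1 i)//= [ltRHS](bigD1 i)//= ltr_leD//.
    by apply: ler_sum => j _; exact: le_cone.
  by rewrite sumE mulrAC divfK// ltxx.
congr EFin; apply: (mulIf n1); rewrite mulrAC divfK// mulr_natl -sumr_const mulr_suml.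
apply: eq_bigr => i _.
exact: (simplex_facet_cone n_gt1 P_polytope P_centered a_inj facets).
Qed.
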